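(* Let $K/k$ be a large extension of algebraically closed analytic fields of topological transcendence degree one, $\mathrm{tr.c}(K/k)=1$, with $\mathrm{char}(\widetilde k)>0$. Then the ordered set $I_{K/k}$ of intermediate algebraically closed analytic fields $k\subseteq F\subseteq K$ (with its order topology) is homeomorphic to an Alexandroff ray (also known as a long ray) compactified by adding a point at infinity.
   Context: An analytic field is a field complete with respect to a real-valued (rank at most one, possibly trivial) multiplicative non-archimedean absolute value $|\ |$; $\widetilde k$ denotes the residue field. An extension of analytic fields is a field extension in which the absolute value of the larger field restricts to that of the smaller one. An intermediate analytic field is an intermediate field complete with respect to the induced absolute value. $K^a$ denotes an algebraic closure with the extended absolute value, $\widehat{\ \cdot\ }$ denotes completion. For an extension $K/k$ and a subset $S\subset K$, $\widehat{k(S)^a}$ denotes the closure in $\widehat{K^a}$ of the algebraic closure of $k(S)$. A set $S\subset K$ is t.a. (topologically-algebraically) independent over $k$ if $\widehat{k(S')^a}\subsetneq\widehat{k(S)^a}$ for any $S'\subsetneq S$, and it is t.a. generating for $K/k$ if $\widehat{K^a}=\widehat{k(S)^a}$. The topological generating degree $\mathrm{Tr.c}(K/k)$ is the minimum of the cardinalities of t.a. generating sets, and the topological transcendence degree $\mathrm{tr.c}(K/k)$ is the supremum of the cardinalities of t.a. independent sets. The extension is large if $\mathrm{Tr.c}(K/k)$ is infinite. When $\mathrm{tr.c}(K/k)=1$, the set $I_{K/k}$ is known to be totally ordered by inclusion. The (closed) long ray is $\omega_1\times[0,1)$ with the order topology of the lexicographic order; its compactification adds one maximal point at infinity. *)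

(* Defs.v *)
From HB Require Import structures.
From mathcomp Require Import all_boot all_order all_algebra.
From mathcomp Require Import ring_quotient.
From mathcomp Require Import all_classical all_reals topology.
From mathcomp Require wochoice.

Set Implicit Arguments.
Unset Strict Implicit.
Unset Printing Implicit Defensive.

Import Order.TTheory GRing.Theory Num.Theory.
Local Open Scope classical_set_scope.
Local Open Scope ring_scope.
Local Open Scope quotient_scope.
Local Open Scope card_scope.

(* The norms of [Num.NormedZmodule] satisfy `|x *+ n| = `|x| *+ n, which excludes
   non-archimedean absolute values; hence a separate mixin, on top of the
   library's complete pseudometric spaces. *)
HB.mixin Record Field_isAnalytic (R : realType) K
    & GRing.Field K & CompletePseudoMetric R K := {
  absv : K -> R;
  absv_ge0 : forall x, 0 <= absv x;
  absv_eq0 : forall x, (absv x == 0) = (x == 0);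
  absvM : forall x y, absv (x * y) = absv x * absv y;
  absvD : forall x y, absv (x + y) <= Num.max (absv x) (absv y);
  ball_absvE : forall (x : K) (e : R), ball x e = [set y | absv (x - y) < e]
}.

#[short(type="analyticFieldType")]
HB.structure Definition AnalyticField (R : realType) :=
  { K of GRing.Field K & CompletePseudoMetric R K & Field_isAnalytic R K }.

Arguments absv {R K} x : rename.

Section ResidueField.
Context {R : realType} {K : analyticFieldType R}.
Implicit Types x y : K.

Lemma absv0 : absv (0 : K) = 0.
Proof. by apply/eqP; rewrite absv_eq0. Qed.

Lemma absv1 : absv (1 : K) = 1.
Proof.
have nz : absv (1 : K) != 0 by rewrite absv_eq0 oner_eq0.
by apply: (mulfI nz); rewrite -absvM !mulr1.
Qed.

Lemma absvN x : absv (- x) = absv x.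
Proof.
have N1 : absv (-1 : K) = 1.
  apply/eqP; rewrite -(@eqrXn2 _ 2) ?absv_ge0 // expr1n expr2.
  by rewrite -absvM mulrNN mul1r absv1.
by rewrite -mulN1r absvM N1 mul1r.
Qed.

Lemma absvV x : absv x^-1 = (absv x)^-1.
Proof.
have [->|x0] := eqVneq x 0; first by rewrite invr0 absv0 invr0.
have nz : absv x != 0 by rewrite absv_eq0.
by apply: (mulfI nz); rewrite -absvM !divff // absv1.
Qed.

Definition valring_pred : {pred K} := fun x => absv x <= 1.

Lemma valring_subring_closed : subring_closed valring_pred.
Proof.
split => [|x y|x y]; rewrite !unfold_in /valring_pred ?absv1 // => x1 y1.
  by apply: le_trans (absvD _ _) _; rewrite absvN ge_max x1.
by rewrite absvM mulr_ile1 ?absv_ge0.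
Qed.

HB.instance Definition _ := GRing.isSubringClosed.Build K valring_pred
  valring_subring_closed.

Record valring := Valring { valring_val : K; _ : valring_pred valring_val }.
HB.instance Definition _ := [isSub for valring_val].
HB.instance Definition _ := [Choice of valring by <:].
HB.instance Definition _ := [SubChoice_isSubComNzRing of valring by <:].

Definition maxideal : {pred valring} := fun a => absv (val a : K) < 1.

Lemma maxideal_idealr_closed : idealr_closed maxideal.
Proof.
split => [||a u v]; rewrite !unfold_in /maxideal ?rmorph0 ?rmorph1.
- by rewrite absv0.
- by rewrite absv1 ltxx.
move=> u1 v1; rewrite rmorphD rmorphM.
apply: le_lt_trans (absvD _ _) _; rewrite gt_max v1 andbT absvM.
by apply: le_lt_trans u1; rewrite ler_piMl ?absv_ge0 //; exact: valP a.
Qed.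

HB.instance Definition _ := isIdealr.Build valring maxideal
  maxideal_idealr_closed.

Definition residue_field := {ideal_quot maxideal}.
HB.instance Definition _ := GRing.ComNzRing.on residue_field.

Lemma residue_invP (a : residue_field) : exists b : residue_field,
  if a == 0 then b = 0 else b * a = 1.
Proof.
case: eqP => [_|/eqP]; first by exists 0.
rewrite -[a]reprK; set x := repr a => x0.
have x1 : absv (val x : K) = 1.
  apply/eqP; rewrite eq_le (valP x : absv _ <= 1) /= leNgt.
  by apply: contraNN x0 => x1; rewrite piE Quotient.equivE subr0.
have xV : valring_pred (val x)^-1 by rewrite /valring_pred absvV x1 invr1.
have nz : val x != 0 by rewrite -absv_eq0 x1 oner_neq0.
exists (\pi_residue_field (Valring xV)).
rewrite -[RHS](rmorph1 (\pi_residue_field)) -[LHS](rmorphM (\pi_residue_field)).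
by congr (\pi_residue_field _); apply: val_inj; rewrite rmorphM rmorph1 /= mulVf.
Qed.

Definition residue_inv (a : residue_field) := sval (cid (residue_invP a)).

Lemma residue_mulVf a : a != 0 -> residue_inv a * a = 1.
Proof. by rewrite /residue_inv; case: cid => b /=; case: ifP. Qed.

Lemma residue_inv0 : residue_inv 0 = 0.
Proof. by rewrite /residue_inv; case: cid => b /=; rewrite eqxx. Qed.

HB.instance Definition _ := GRing.ComNzRing_isField.Build residue_field
  residue_mulVf residue_inv0.

End ResidueField.
Arguments residue_field {R} K.

Section IntermediateFields.
Context {R : realType}.

Definition is_subfield {K : fieldType} (F : set K) : Prop :=
  GRing.divring_closed (mem F).

Definition is_complete {K : analyticFieldType R} (F : set K) : Prop :=
  forall G : set_system K, ProperFilter G -> G F -> cauchy G ->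
    exists2 x, F x & G --> x.

(* For a subfield [F]: the field [F] itself is algebraically closed. *)
Definition is_alg_closed {K : fieldType} (F : set K) : Prop :=
  forall p : {poly K}, p \is a polyOver (mem F) -> (1 < size p)%N ->
    exists2 x, F x & root p x.

Context {k K : analyticFieldType R} (iota : {rmorphism k -> K}).

Definition interm_pred (F : set K) : bool :=
  `[< [/\ is_subfield F, range iota `<=` F,
          is_complete F & is_alg_closed F] >].

(* The set I_{K/k}; its order is the inclusion order on [set K]. *)
Record interm := Interm { interm_val : set K; _ : interm_pred interm_val }.
HB.instance Definition _ := [isSub for interm_val].
HB.instance Definition _ := [Choice of interm by <:].
HB.instance Definition _ :=
  [SubChoice_isSubPOrder of interm by <: with set_display].

Definition gen_subfield (S : set K) : set K :=
  smallest is_subfield (range iota `|` S).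

(* The elements of [K] algebraic over the subfield [L]. *)
Definition alg_closure (L : set K) : set K :=
  [set x | exists2 p : {poly K},
             p \is a polyOver (mem L) & p != 0 /\ root p x].

(* The notions below are only meant for algebraically closed [K]: since [K] is
   moreover complete, K^a and its completion are then [K] itself, and
   [ta_closure S] is the closure of k(S)^a in the completion of K^a. *)
Definition ta_closure (S : set K) : set K :=
  closure (alg_closure (gen_subfield S)).

Definition ta_independent (S : set K) : Prop :=
  forall S' : set K, S' `<` S -> ta_closure S' `<` ta_closure S.

Definition ta_generating (S : set K) : Prop :=
  closure (alg_closure [set: K]) = ta_closure S.

(* Cardinals are represented by sets, up to equipotence: [is_Trc c] and
   [is_trc c] say that Tr.c(K/k), resp. tr.c(K/k), is the cardinality of [c]. *)
Definition is_Trc {T : Type} (c : set T) : Prop :=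
  (exists2 S, ta_generating S & S #= c) /\
  (forall S, ta_generating S -> c #<= S).

Definition is_trc {T : Type} (c : set T) : Prop :=
  (forall S, ta_independent S -> S #<= c) /\
  (forall (U : Type) (d : set U),
     (forall S, ta_independent S -> S #<= d) -> c #<= d).

Definition large_ext : Prop :=
  exists2 c : set K, is_Trc c & infinite_set c.

End IntermediateFields.
Arguments interm {R k K} iota.

(* [order_topology] requires the order to be known to be total; this is the
   same construction, from the open rays, for an arbitrary partial order. *)
Definition porder_topology (T : Type) : Type := T.

Section PorderTopology.
Context {d : Order.disp_t} {T : porderType d}.
Definition ray_index : Type := interval T.
HB.instance Definition _ := Choice.on ray_index.
HB.instance Definition _ := isPointed.Build ray_index `]-oo, +oo[.
HB.instance Definition _ := Order.POrder.on (porder_topology T).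
HB.instance Definition _ := @isSubBaseTopological.Build (porder_topology T)
  ray_index itv_is_open_unbounded (fun i => [set` i]).
End PorderTopology.

Lemma porder_topologyE d (T : orderType d) :
  @open (porder_topology T) = @open (order_topology T).
Proof. by []. Qed.

Definition homeomorphic (X Y : topologicalType) : Prop :=
  exists (f : X -> Y) (g : Y -> X),
    [/\ cancel f g, cancel g f, continuous f & continuous g].

(* The ordinal omega_1, realized as the set of elements with countably many
   predecessors in a (chosen) well-ordering of the uncountable set [set nat]. *)
Section Omega1.

Definition wo_powerset : Type := set nat.
HB.instance Definition _ := Choice.copy wo_powerset (set nat).

Definition wo_le : rel wo_powerset :=
  sval (wochoice.well_ordering_principle wo_powerset).

Lemma wo_leP : wochoice.well_order wo_le.
Proof. exact: (svalP (wochoice.well_ordering_principle wo_powerset)). Qed.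

Let wo_chain_le : wochoice.wo_chain wo_le predT.
Proof. by move=> A _; exact: wo_leP. Qed.

Lemma wo_le_total : total wo_le.
Proof. exact: (in2T (wochoice.wo_chainW wo_chain_le)). Qed.

Lemma wo_le_anti : antisymmetric wo_le.
Proof. exact: (in2T (wochoice.wo_chain_antisymmetric wo_chain_le)). Qed.

Lemma wo_le_refl : reflexive wo_le.
Proof. exact: (in1T (wochoice.wo_chain_reflexive wo_chain_le)). Qed.

Lemma wo_le_trans : transitive wo_le.
Proof.
move=> y x z xy yz.
have [|m [[mA mP] _]] := wo_leP (A := pred3 x y z).
  by exists x; rewrite !inE eqxx.
have [mx my mz] : [/\ wo_le m x, wo_le m y & wo_le m z].
  by split; apply: mP; rewrite !inE eqxx ?orbT.
move: mA; rewrite !inE => /or3P[] /eqP mE; first by rewrite -mE.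
- by rewrite (wo_le_anti (x := x) (y := y)) // xy -mE mx.
- by rewrite (wo_le_anti (x := y) (y := z)) // ?yz -?mE ?my // in xy.
Qed.

Fact wo_display : Order.disp_t. Proof. exact. Qed.
HB.instance Definition _ := Order.Le_isPOrder.Build wo_display wo_powerset
  wo_le_refl wo_le_anti wo_le_trans.
HB.instance Definition _ :=
  Order.POrder_isTotal.Build wo_display wo_powerset wo_le_total.

Definition countably_many_pred (x : wo_powerset) : bool :=
  `[< countable [set y | (y < x)%O] >].

Record omega1 :=
  Omega1 { omega1_val : wo_powerset; _ : countably_many_pred omega1_val }.
HB.instance Definition _ := [isSub for omega1_val].
HB.instance Definition _ := [Choice of omega1 by <:].
HB.instance Definition _ :=
  [SubChoice_isSubOrder of omega1 by <: with wo_display].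

Lemma omega1_wf (A : set omega1) : A !=set0 ->
  exists2 x, A x & forall y, A y -> (x <= y)%O.
Proof.
move=> [a Aa].
have [|m [[/asboolP[x Ax <-] mP] _]] :=
  wo_leP (A := fun u => `[< (omega1_val @` A) u >]).
  by exists (omega1_val a); apply/asboolP; exists a.
by exists x => // y Ay; apply: mP; apply/asboolP; exists y.
Qed.

Lemma omega1_initial_segment (x : omega1) : countable [set y | (y < x)%O].
Proof.
have /asboolP/countable_injP[f finj] := valP x.
apply/countable_injP; exists (f \o val) => y z /set_mem yx /set_mem zx fyz.
by apply/val_inj/finj => //; exact/mem_set.
Qed.

Lemma omega1_uncountable : ~ countable [set: omega1].
Proof.
case/countable_injP => f finj.
have [|/existsNP[u0 u0N]] := pselect (forall u, countably_many_pred u).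
  move=> allA; pose g (S : set nat) := f (Omega1 (allA S)).
  have ginj S S' : g S = g S' -> S = S'.
    by move=> /finj; rewrite !in_setT => /(_ isT isT) [].
  pose D := [set n | exists2 S, g S = n & ~ S n].
  have [DgD|nDgD] := pselect (D (g D)); last by apply: (nDgD); exists D.
  by case: (DgD) => S /ginj ->.
have [|z [[zN zP] _]] := wo_leP (A := fun u => ~~ countably_many_pred u).
  by exists u0; exact/negP.
have below u : (u < z)%O -> countably_many_pred u.
  move=> uz; apply: contraT => uN.
  by have := zP u uN; rewrite -[wo_le z u]/((z <= u)%O) leNgt uz.
apply: (negP zN); apply/asboolP/countable_injP.
pose h u :=
  if pselect (countably_many_pred u) is left P then f (Omega1 P) else 0%N.
exists h => u v /set_mem uz /set_mem vz; rewrite /h.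
case: pselect => [Pu|/(_ (below _ uz))//].
case: pselect => [Pv|/(_ (below _ vz))//].
by move=> /finj; rewrite !in_setT => /(_ isT isT) [].
Qed.

End Omega1.

Section HalfOpenUnitInterval.
Context (R : realType).
Record ico01 := Ico01 { ico01_val : R; _ : 0 <= ico01_val < 1 }.
HB.instance Definition _ := [isSub for ico01_val].
HB.instance Definition _ := [Choice of ico01 by <:].
HB.instance Definition _ :=
  [SubChoice_isSubOrder of ico01 by <: with ring_display].
End HalfOpenUnitInterval.

Definition long_ray (R : realType) : Type := (omega1 *l ico01 R)%type.
HB.instance Definition _ (R : realType) := Order.Total.on (long_ray R).

(* [T] with a greatest element [None] added. *)
Definition with_top (T : Type) : Type := option T.

Section WithTop.
Context {d : Order.disp_t} {T : orderType d}.

HB.instance Definition _ := Choice.on (with_top T).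

Definition with_top_le : rel (with_top T) := fun x y =>
  match x, y with
  | _, None => true
  | None, Some _ => false
  | Some a, Some b => (a <= b)%O
  end.

Lemma with_top_le_refl : reflexive with_top_le.
Proof. by case=> /=. Qed.

Lemma with_top_le_anti : antisymmetric with_top_le.
Proof. by case=> [a|] [b|] //= /le_anti->. Qed.

Lemma with_top_le_trans : transitive with_top_le.
Proof. by case=> [a|] [b|] [c|] //=; exact: le_trans. Qed.

Lemma with_top_le_total : total with_top_le.
Proof. by case=> [a|] [b|] //=; exact: le_total. Qed.

HB.instance Definition _ := Order.Le_isPOrder.Build d (with_top T)
  with_top_le_refl with_top_le_anti with_top_le_trans.
HB.instance Definition _ :=
  Order.POrder_isTotal.Build d (with_top T) with_top_le_total.

End WithTop.

(* Main.v *)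
(* The intermediate fields form a chain because [tr.c(K/k) = 1] says that, for all
   [x] and [y], one of them lies in the topological algebraic closure of the
   other. For [x] outside [F], let [dist x F] be the distance from [x] to [F].

   (1) [dist x] is strictly decreasing on the chain of fields avoiding [x]. If
   [F < G] and [y] is in [G] but not in [F], then [y] is close to some [y0]
   algebraic over [k(x)], so [W(x, y0) = 0] for some polynomial [W] over [F]; as
   all roots of univariate polynomials over [F] are in [F], moving [y0] to [y]
   changes the coefficients of [W(., y0)], expanded at any point of [F], by a
   relative factor smaller than 1, and comparing Gauss norms shows that
   [W(., y)] has a root at distance less than [dist x F] from [x].

   (2) [dist x] takes all values in ]0, dist x F] on the fields containing [F].
   The point is the absence of gaps. Let [E] be the field topologically generated
   by [x]; it is not [K] as [K/k] is large, so there is [u] with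
   [dist u E <= absv u < dist x F] and [dist u E] close to [dist x F]. There is an
   isometry over [F] from [E] into [K] mapping [x] to [x + u], and the preimage
   of [E] is a field whose distance to [x] is at least [dist u E].

   (3) By Baire's theorem, countably many proper fields are contained in a proper
   field generated by one element.

   Hence initial segments of the chain look like real intervals, no countable
   set is cofinal in the proper fields, and a transfinite sequence of length
   omega_1 glues these intervals to a long ray. *)
Require Import Defs.
From HB Require Import structures.
From mathcomp Require Import all_boot all_order all_algebra.
From mathcomp Require Import finmap.
From mathcomp Require Import all_classical all_reals topology.
From mathcomp Require Import ring lra zify.

Set Implicit Arguments.
Unset Strict Implicit.
Unset Printing Implicit Defensive.

Import Order.TTheory GRing.Theory Num.Theory.
Local Open Scope classical_set_scope.
Local Open Scope ring_scope.

(** * Limits and polynomials over subfields *)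

Section AbsoluteValue.
Context {R : realType} {K : analyticFieldType R}.
Implicit Types (x y z : K) (e r : R).

Lemma absvBC x y : absv (x - y) = absv (y - x).
Proof. by rewrite -absvN opprB. Qed.

Lemma absvB x y : absv (x - y) <= Num.max (absv x) (absv y).
Proof. by rewrite -(absvN y) absvD. Qed.

Lemma absv_gt0 x : (0 < absv x) = (x != 0).
Proof. by rewrite lt_neqAle absv_ge0 andbT eq_sym absv_eq0. Qed.

Lemma absv_le0 x : (absv x <= 0) = (x == 0).
Proof. by rewrite -absv_eq0 eq_le absv_ge0 andbT. Qed.

Lemma absvX x n : absv (x ^+ n) = absv x ^+ n.
Proof. by elim: n => [|n IH]; rewrite ?expr0 ?absv1 // !exprS absvM IH. Qed.

Lemma absv_addl x y : absv y < absv x -> absv (x + y) = absv x.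
Proof.
move=> yx; apply/eqP; rewrite eq_le; apply/andP; split.
  by apply: le_trans (absvD _ _) _; rewrite ge_max lexx ltW.
have := absvB (x + y) y; rewrite addrK le_max => /orP[//|xy].
by have := lt_le_trans yx xy; rewrite ltxx.
Qed.

Lemma absv_close x y : absv (x - y) < absv x -> absv y = absv x.
Proof.
by move=> xy; rewrite -[y in LHS](subKr x) absv_addl ?absvN // opprB.
Qed.

Lemma absv_dist_trans x y z e :
  absv (x - y) < e -> absv (y - z) < e -> absv (x - z) < e.
Proof.
move=> xy yz; rewrite -(subrKA y); apply: le_lt_trans (absvD _ _) _.
by rewrite gt_max xy.
Qed.

Lemma absv_mul_close x y e :
  0 < e -> exists2 d : R, 0 < d & forall a b, absv (x - a) < d ->
    absv (y - b) < d -> absv (x * y - a * b) < e.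
Proof.
move=> e0; set M : R := absv x + absv y + 1.
have [x0 y0] : 0 <= absv x /\ 0 <= absv y by rewrite !absv_ge0.
have M0 : 0 < M by rewrite /M; lra.
exists (Num.min 1 (e / M)) => [|a b]; first by rewrite lt_min ltr01 divr_gt0.
rewrite !lt_min !ltr_pdivlMr // => /andP[xa1 xaM] /andP[_ ybM].
have -> : x * y - a * b = (x - a) * y + a * (y - b) by ring.
apply: le_lt_trans (absvD _ _) _; rewrite gt_max !absvM; apply/andP; split.
  apply: le_lt_trans xaM; rewrite ler_wpM2l ?absv_ge0 // /M; lra.
apply: le_lt_trans ybM; rewrite mulrC ler_wpM2l ?absv_ge0 //.
rewrite -[a](subKr x); apply: le_trans (absvB _ _) _.
by rewrite ge_max /M; apply/andP; split; lra.
Qed.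

Lemma absv_sum (I : Type) (s : seq I) (P : pred I) (f : I -> K) e :
  0 <= e -> (forall i, P i -> absv (f i) <= e) ->
  absv (\sum_(i <- s | P i) f i) <= e.
Proof.
move=> e0 fe; elim/big_ind: _ => [|x y xe ye|//]; first by rewrite absv0.
by apply: le_trans (absvD _ _) _; rewrite ge_max xe.
Qed.

Lemma absv_prod (I : Type) (s : seq I) (f : I -> K) :
  absv (\prod_(i <- s) f i) = \prod_(i <- s) absv (f i).
Proof. by apply: (big_morph absv absvM absv1). Qed.

Definition adherence (A : set K) x :=
  forall e, 0 < e -> exists2 a, A a & absv (x - a) < e.

Lemma closure_adherence (A : set K) : closure A = adherence A.
Proof.
apply/seteqP; split => x /=.
  move=> clA e e0.
  have /clA[a [Aa]] : nbhs x (ball x e) by exact: nbhsx_ballx.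
  by rewrite ball_absvE; exists a.
move=> lA B /nbhs_ballP[e /= e0 eB].
have [a Aa xa] := lA e e0; exists a; split => //; apply: eB.
by rewrite ball_absvE.
Qed.

Definition lim_closed (A : set K) := forall x, adherence A x -> A x.

Lemma is_complete_lim_closed (A : set K) : is_complete A -> lim_closed A.
Proof.
move=> cA x lx; pose G := within A (nbhs x).
have GF : ProperFilter G.
  apply: within_nbhs_proper; rewrite closure_adherence; exact: lx.
have GA : G A by rewrite /G/= /within/=; exact: nearW.
have cG : cauchy G.
  apply/cauchyP => e e0; exists x.
  exact: (@cvg_within _ (nbhs x) _ A _ (nbhsx_ballx x e e0)).
have [y Ay Gy] := cA G GF GA cG.
suff -> : x = y by [].
apply/eqP; rewrite -subr_eq0 -absv_eq0; apply: contraT => xy.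
have e0 : 0 < absv (x - y) by rewrite lt_neqAle eq_sym xy absv_ge0.
have Gb : G (ball y (absv (x - y))) by apply: Gy; exact: nbhsx_ballx.
have Gx : G (ball x (absv (x - y))).
  exact: (@cvg_within _ (nbhs x) _ A _ (nbhsx_ballx x _ e0)).
have [z []] := filter_ex (filterI Gb Gx).
rewrite !ball_absvE /= => yz xz.
have zy : absv (z - y) < absv (x - y) by rewrite (absvBC z).
by have := absv_dist_trans xz zy; rewrite ltxx.
Qed.

Lemma lim_closed_is_complete (A : set K) : lim_closed A -> is_complete A.
Proof.
move=> lA G GF GA cG.
have Gcvg : cvg G by exact: cauchy_cvg.
exists (lim G) => //; apply: lA => e e0.
have Gb : G (ball (lim G) e) by apply: Gcvg; exact: nbhsx_ballx.
have [a []] := filter_ex (filterI Gb GA).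
by rewrite ball_absvE; exists a.
Qed.

Definition abs_cauchy (u : nat -> K) :=
  forall e, 0 < e -> exists N, forall m n, (N <= m)%N -> (N <= n)%N ->
    absv (u m - u n) < e.

Definition abs_lim (u : nat -> K) x :=
  forall e, 0 < e -> exists N, forall n, (N <= n)%N -> absv (x - u n) < e.

Lemma abs_cauchy_cvg (u : nat -> K) : abs_cauchy u -> exists x, abs_lim u x.
Proof.
move=> cu; have /cauchy_cvg/= Gcvg : cauchy (u @ \oo).
  apply/cauchyP => e e0; have [N uN] := cu e e0.
  exists (u N) => /=; exists N => // n /= Nn; rewrite /= ball_absvE /=.
  exact: uN.
exists (lim (u @ \oo)) => e e0.
have [N _ uN] : (u @ \oo) (ball (lim (u @ \oo)) e).
  by apply: Gcvg; exact: nbhsx_ballx.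
by exists N => n /uN /=; rewrite ball_absvE.
Qed.

Lemma adherence_seq (A : set K) x : adherence A x ->
  exists u : nat -> K, (forall n, A (u n)) /\ abs_lim u x.
Proof.
move=> lx; have /choice[u uP] n : exists a, A a /\ absv (x - a) < n.+1%:R^-1.
  by have [|a] := lx n.+1%:R^-1; [rewrite invr_gt0|exists a].
exists u; split=> [n|e e0]; first by case: (uP n).
exists (Num.truncn e^-1).+1 => n Nn; apply: lt_trans (uP n).2 _.
rewrite invf_plt ?posrE //; apply: lt_le_trans (truncnS_gt _) _.
by rewrite ler_nat (leq_trans Nn).
Qed.

Lemma abs_lim_cauchy (u : nat -> K) x : abs_lim u x -> abs_cauchy u.
Proof.
move=> ux e e0; have [N uN] := ux e e0; exists N => m n Nm Nn.
by apply: (absv_dist_trans (y := x)); [rewrite absvBC|]; exact: uN.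
Qed.

Lemma lim_point (A : set K) (u : nat -> K) x :
  (forall n, A (u n)) -> abs_lim u x -> adherence A x.
Proof. by move=> Au ux e /ux[N uN]; exists (u N) => //; exact: uN. Qed.

End AbsoluteValue.

(** * Subfields and polynomials with coefficients in them *)

Section Subfields.
Context {K : fieldType} (F : set K) (sF : is_subfield F).
Implicit Types (x y : K).

Lemma subfield1 : F 1.
Proof. by case: sF => F1 _ _; move: F1; rewrite inE. Qed.

Lemma subfieldB x y : F x -> F y -> F (x - y).
Proof. by case: sF => _ FB _ Fx Fy; apply/set_mem/FB; exact/mem_set. Qed.

Lemma subfield_div x y : F x -> F y -> F (x / y).
Proof. by case: sF => _ _ FV Fx Fy; apply/set_mem/FV; exact/mem_set. Qed.

Lemma subfield0 : F 0.
Proof. by rewrite -(subrr 1); apply: subfieldB; exact: subfield1. Qed.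

Lemma subfieldN x : F x -> F (- x).
Proof. by move=> Fx; rewrite -sub0r; apply: subfieldB => //; exact: subfield0. Qed.

Lemma subfieldD x y : F x -> F y -> F (x + y).
Proof. by move=> Fx Fy; rewrite -(opprK y); apply/subfieldB/subfieldN. Qed.

Lemma subfieldV x : F x -> F x^-1.
Proof. by move=> Fx; rewrite -div1r; apply: subfield_div => //; exact: subfield1. Qed.

Lemma subfieldM x y : F x -> F y -> F (x * y).
Proof. by move=> Fx Fy; rewrite -(invrK y); apply/subfield_div/subfieldV. Qed.

Lemma subfieldX x n : F x -> F (x ^+ n).
Proof.
move=> Fx; elim: n => [|n IH]; first exact: subfield1.
by rewrite exprS; exact: subfieldM.
Qed.

Lemma subfield_sum (I : Type) (s : seq I) (P : pred I) (f : I -> K) :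
  (forall i, P i -> F (f i)) -> F (\sum_(i <- s | P i) f i).
Proof. by move=> Ff; apply: big_ind => //; [exact: subfield0|exact: subfieldD]. Qed.

End Subfields.

Lemma is_subfieldI (K : fieldType) (F : set K) : F 1 ->
  (forall x y, F x -> F y -> F (x - y)) ->
  (forall x y, F x -> F y -> F (x / y)) -> is_subfield F.
Proof.
move=> F1 FB FV; split; first exact/mem_set.
  by move=> x y /set_mem Fx /set_mem Fy; exact/mem_set/FB.
by move=> x y /set_mem Fx /set_mem Fy; exact/mem_set/FV.
Qed.

Definition coefs_in (K : nzSemiRingType) (F : set K) (p : {poly K}) :=
  forall i, F p`_i.

Lemma polyOver_coefs_in (K : nzSemiRingType) (F : set K) (p : {poly K}) :
  F 0 -> p \is a polyOver (mem F) <-> coefs_in F p.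
Proof.
move=> F0; split=> [/allP Fp i|Fp]; last first.
  by apply/(all_nthP 0) => i _; exact/mem_set.
have [ip|pi] := ltnP i (size p); last by rewrite nth_default.
exact/set_mem/Fp/mem_nth.
Qed.

Lemma coefs_inX (K : fieldType) (F : set K) : is_subfield F -> coefs_in F 'X.
Proof.
by move=> sF i; rewrite coefX; case: eqP => _; [exact: subfield1|exact: subfield0].
Qed.

Lemma coefs_inC (K : fieldType) (F : set K) c :
  is_subfield F -> F c -> coefs_in F c%:P.
Proof. by move=> sF Fc i; rewrite coefC; case: eqP => _ //; exact: subfield0. Qed.

Lemma coefs_inB (K : fieldType) (F : set K) p q :
  is_subfield F -> coefs_in F p -> coefs_in F q -> coefs_in F (p - q).
Proof. by move=> sF Fp Fq i; rewrite coefB; exact: subfieldB. Qed.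

Lemma coefs_inD (K : fieldType) (F : set K) p q :
  is_subfield F -> coefs_in F p -> coefs_in F q -> coefs_in F (p + q).
Proof. by move=> sF Fp Fq i; rewrite coefD; exact: subfieldD. Qed.

Lemma coefs_inM (K : fieldType) (F : set K) p q :
  is_subfield F -> coefs_in F p -> coefs_in F q -> coefs_in F (p * q).
Proof.
move=> sF Fp Fq i; rewrite coefM; apply: subfield_sum => // j _.
exact: subfieldM.
Qed.

Lemma coefs_in_comp (K : fieldType) (F : set K) p q :
  is_subfield F -> coefs_in F p -> coefs_in F q -> coefs_in F (p \Po q).
Proof.
move=> sF Fp Fq.
have Fqn n : coefs_in F (q ^+ n).
  elim: n => [|n IH]; first by apply: coefs_inC => //; exact: subfield1.
  by rewrite exprS; exact: coefs_inM.
move=> i; rewrite coef_comp_poly; apply: subfield_sum => // j _.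
by apply: subfieldM => //; exact: Fqn.
Qed.

(** Comparing coefficients gives [q_i = p_(i+1) + a q_(i+1)], so membership in [F] descends from the
    index [size q], where the coefficient is 0. *)
Lemma coefs_in_factor (K : fieldType) (F : set K) (p : {poly K}) (a : K) :
  is_subfield F -> coefs_in F p -> F a -> root p a ->
  exists2 q, coefs_in F q & p = q * ('X - a%:P).
Proof.
move=> sF Fp Fa /factor_theorem[q pq]; exists q => //.
have step i : F q`_i.+1 -> F q`_i.
  move=> Fq; have := Fp i.+1.
  rewrite pq mulrBr coefB coefMX coefMC /= => FB.
  by rewrite -[q`_i](subrK (q`_i.+1 * a)); apply: subfieldD => //; exact: subfieldM.
have low n i : F q`_(i + n) -> F q`_i.
  by elim: n => [|n IH]; rewrite ?addn0 // addnS => /step.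
move=> i; apply: (low (size q)); rewrite nth_default ?leq_addl //.
exact: subfield0.
Qed.

Definition closed_subfield (K : fieldType) (F : set K) :=
  is_subfield F /\ is_alg_closed F.

Lemma alg_closed_split (K : fieldType) (F : set K) (p : {poly K}) :
  closed_subfield F -> coefs_in F p -> p != 0 ->
  exists2 s : seq K, {in s, forall a, F a} &
    p = lead_coef p *: \prod_(a <- s) ('X - a%:P).
Proof.
move=> [sF aF]; have [n] := ubnP (size p); elim: n p => // n IH p pn Fp p0.
have [p1|p1] := leqP (size p) 1.
  exists [::] => //; rewrite big_nil; have := size1_polyC p1 => ->.
  by rewrite lead_coefC alg_polyC.
have [|a Fa pa] := aF p _ p1; first by apply/polyOver_coefs_in => //; exact: subfield0.
have [q Fq pq] := coefs_in_factor sF Fp Fa pa.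
have q0 : q != 0 by apply: contraNneq p0; rewrite pq => ->; rewrite mul0r.
have [|s Fs qs] := IH q _ Fq q0.
  by move: pn; rewrite pq size_Mmonic ?monicXsubC // size_XsubC addn2 ltnS.
exists (a :: s); first by move=> b; rewrite inE => /orP[/eqP->|/Fs].
rewrite big_cons [p in LHS]pq {1}qs pq lead_coefM lead_coefXsubC mulr1.
by rewrite mulrC scalerAr.
Qed.

Lemma alg_closed_root (K : fieldType) (F : set K) (p : {poly K}) x :
  closed_subfield F -> coefs_in F p -> p != 0 -> root p x -> F x.
Proof.
move=> cF Fp p0; have [s Fs ->] := alg_closed_split cF Fp p0.
by rewrite rootZ ?lead_coef_eq0 // root_prod_XsubC => /Fs.
Qed.

Lemma closed_field_setT (K : fieldType) :
  GRing.closed_field_axiom K -> closed_subfield [set: K].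
Proof.
move=> cK; split; [exact: is_subfieldI|move=> p _ p1].
have p0 : lead_coef p != 0 by rewrite lead_coef_eq0 -size_poly_gt0 ltnW.
have [|x xP] := cK (size p).-1 (fun i => - (p`_i / lead_coef p)).
  by case: (size p) p1 => [|[]].
exists x => //; rewrite /root horner_coef; case: (size p) p1 xP (lead_coefE p) => //= n n0 xP lE.
rewrite big_ord_recr /= xP -lE mulr_sumr -big_split /= big1 // => i _.
by rewrite mulNr mulrN mulrA mulrCA divff // mulr1 subrr.
Qed.

(** * Topological algebraic closures are intermediate fields *)

Section SubfieldType.
Context {K : fieldType} (F : set K) (sF : is_subfield F).

(** Indexing the predicate by the proof of [is_subfield F] allows its closure properties to be
    declared as an instance. *)
Definition subfield_pred of is_subfield F : {pred K} := mem F.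
HB.instance Definition _ := GRing.isDivringClosed.Build K (subfield_pred sF) sF.

Record subfield_of :=
  SubfieldOf { subfield_val :> K; _ : subfield_pred sF subfield_val }.
HB.instance Definition _ := [isSub for subfield_val].
HB.instance Definition _ := [Choice of subfield_of by <:].
HB.instance Definition _ := [SubChoice_isSubComUnitRing of subfield_of by <:].
HB.instance Definition _ :=
  [SubComUnitRing_isSubIntegralDomain of subfield_of by <:].
HB.instance Definition _ :=
  [SubIntegralDomain_isSubField of subfield_of by <:].

Lemma subfield_valP (a : subfield_of) : F (val a).
Proof. by have := valP a; rewrite /subfield_pred => /set_mem. Qed.

Lemma subfield_of_ex x : F x -> exists a : subfield_of, val a = x.
Proof. by move=> Fx; exists (SubfieldOf (mem_set Fx)). Qed.

Lemma coefs_in_map (p : {poly subfield_of}) : coefs_in F (map_poly val p).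
Proof. by move=> i; rewrite coef_map /=; exact: subfield_valP. Qed.

Lemma coefs_in_lift p : coefs_in F p ->
  exists q : {poly subfield_of}, p = map_poly val q.
Proof.
move=> Fp; exists (\poly_(i < size p) SubfieldOf (mem_set (Fp i))).
apply/polyP => i; rewrite coef_map /= coef_poly; case: ltnP => [//|pi].
by rewrite nth_default.
Qed.

End SubfieldType.

Section AlgebraicClosure.
Context {R : realType} {K : analyticFieldType R} (F : set K).
Hypothesis sF : is_subfield F.

Lemma alg_closureP x : alg_closure F x <->
  algebraicOver (val : subfield_of sF -> K) x.
Proof.
split=> [[p /(polyOver_coefs_in _ (subfield0 sF)) Fp [p0 px]]|[p p0 px]].
  have [q pE] := coefs_in_lift sF Fp; exists q; rewrite -?pE //.
  by move: p0; rewrite pE map_poly_eq0.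
exists (map_poly val p); last by rewrite map_poly_eq0.
by apply/(polyOver_coefs_in _ (subfield0 sF)); exact: coefs_in_map.
Qed.

Lemma alg_closure_closed : closed_subfield [set: K] ->
  closed_subfield (alg_closure F).
Proof.
move=> [_ aK].
have sA : is_subfield (alg_closure F).
  apply: is_subfieldI; first exact/alg_closureP/algebraic1.
    move=> x y /alg_closureP Ax /alg_closureP Ay.
    by apply/alg_closureP; exact: algebraic_sub.
  move=> x y /alg_closureP Ax /alg_closureP Ay.
  by apply/alg_closureP; exact: algebraic_div.
split=> // p /(polyOver_coefs_in _ (subfield0 sA)) Ap p1.
have [|x _ px] := aK p _ p1; first by apply/polyOver_coefs_in.
exists x => //; apply/alg_closureP/integral_algebraic.
apply: (integral_root _ px); first by rewrite -size_poly_gt0 ltnW.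
move=> _ /(nthP 0)[i _ <-].
by apply/integral_algebraic/alg_closureP; exact: Ap.
Qed.

Lemma sub_alg_closure : F `<=` alg_closure F.
Proof.
move=> x /(subfield_of_ex sF)[a <-]; exact/alg_closureP/algebraic_id.
Qed.

End AlgebraicClosure.

Section Closure.
Context {R : realType} {K : analyticFieldType R}.
Implicit Types (F : set K) (x y : K).

Lemma sub_adherence F : F `<=` adherence F.
Proof. by move=> x Fx e e0; exists x => //; rewrite subrr absv0. Qed.

Lemma adherence_closed F : lim_closed (adherence F).
Proof.
move=> x lx e e0; have [y ly xy] := lx e e0; have [a Fa ya] := ly e e0.
by exists a => //; exact: absv_dist_trans xy ya.
Qed.

Lemma adherence_sub F G : F `<=` G -> adherence F `<=` adherence G.
Proof. by move=> FG x Fx e /Fx[a /FG Ga xa]; exists a. Qed.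

Lemma adherence_subfield F : is_subfield F -> is_subfield (adherence F).
Proof.
move=> sF; apply: is_subfieldI.
- by apply: sub_adherence; exact: subfield1.
- move=> x y lx ly e e0; have [a Fa xa] := lx e e0; have [b Fb yb] := ly e e0.
  exists (a - b); first exact: subfieldB.
  have -> : x - y - (a - b) = (x - a) - (y - b) by ring.
  by apply: le_lt_trans (absvB _ _) _; rewrite gt_max xa.
have lV y : adherence F y -> adherence F y^-1.
  have [->|y0] := eqVneq y 0; first by rewrite invr0.
  move=> ly e e0; have yp : 0 < absv y by rewrite absv_gt0.
  (* The first bound forces [absv b = absv y], hence [b != 0]; the second suffices because
     [1/y - 1/b] then has absolute value [absv (b - y) / absv y ^+ 2]. *)
  have [|b Fb] := ly (Num.min (absv y) (e * absv y ^+ 2)).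
    by rewrite lt_min yp mulr_gt0 // exprn_gt0.
  rewrite lt_min => /andP[/absv_close by1 by2].
  have b0 : b != 0 by rewrite -absv_gt0 by1.
  exists b^-1; first exact: subfieldV.
  have -> : y^-1 - b^-1 = (b - y) / (y * b).
    by rewrite invfM mulrBl mulrCA divff // mulr1 mulrA divff // mul1r.
  rewrite absvM absvV absvM by1 ltr_pdivrMr ?mulr_gt0 //.
  by rewrite absvBC -expr2.
move=> x y lx /lV; move: (y^-1) => {}y ly e e0.
have [d d0 dP] := absv_mul_close x y e0.
have [a Fa xa] := lx d d0; have [b Fb yb] := ly d d0.
by exists (a * b); [exact: subfieldM|exact: dP].
Qed.

(* A root [x] of a monic polynomial over the closure of [F] almost annihilates
   a monic polynomial over [F], hence is close to one of the roots of the
   latter. *)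
Lemma adherence_alg_closed F : closed_subfield [set: K] ->
  closed_subfield F -> closed_subfield (adherence F).
Proof.
move=> [_ aK] cF; have sF := cF.1; have sL := adherence_subfield sF.
split=> // p /(polyOver_coefs_in _ (subfield0 sL)) Lp p1.
have [|x _ px] := aK p _ p1; first by apply/polyOver_coefs_in.
exists x => // e e0; set n := (size p).-1.
have n0 : (0 < n)%N by rewrite /n; case: (size p) p1 => [|[]].
have lc0 : lead_coef p != 0 by rewrite lead_coef_eq0 -size_poly_gt0 ltnW.
pose c i := p`_i / lead_coef p.
have Lc i : adherence F (c i) by apply: (subfield_div sL); exact: Lp.
have cx : x ^+ n + \sum_(i < n) c i * x ^+ i = 0.
  have := rootP px; rewrite horner_coef (_ : size p = n.+1); last first.
    by rewrite /n prednK // ltnW.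
  rewrite big_ord_recr /= -lead_coefE => pE.
  apply: (mulfI lc0); rewrite mulr0 -[RHS]pE mulrDr addrC; congr (_ + _).
  rewrite mulr_sumr; apply: eq_bigr => i _.
  by rewrite /c mulrA mulrCA divff // mulr1.
(* [M] dominates the powers of [absv x] below [n], so replacing each [c i] by some [b i] in [F] with
   error below [e ^+ n / M] gives [absv q.[x] < e ^+ n]. If all [n] roots of [q] were at distance at
   least [e] from [x], the value would be at least [e ^+ n]. *)
pose M := (1 + absv x) ^+ n.
have x1 : 1 <= 1 + absv x by rewrite lerDl absv_ge0.
have M0 : 0 < M by rewrite exprn_gt0 // (lt_le_trans ltr01).
have /choice[b bP] i : exists b, F b /\ absv (c i - b) < e ^+ n / M.
  have [|b Fb cb] := Lc i (e ^+ n / M); last by exists b.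
  by rewrite divr_gt0 // exprn_gt0.
pose q := 'X^n + \poly_(i < n) b i.
have qn : (size (\poly_(i < n) b i) < size ('X^n : {poly K}))%N.
  by rewrite size_polyXn ltnS size_poly.
have q_monic : lead_coef q = 1 by rewrite lead_coefDl // lead_coefXn.
have q_size : size q = n.+1 by rewrite size_polyDl // size_polyXn.
have q0 : q != 0 by rewrite -size_poly_gt0 q_size.
have Fq : coefs_in F q.
  move=> i; rewrite coefD coefXn coef_poly; apply: (subfieldD sF).
    by case: eqP => _; [exact: subfield1|exact: subfield0].
  by case: ifP => _; [case: (bP i)|exact: subfield0].
have [s Fs qs] := alg_closed_split cF Fq q0.
rewrite q_monic scale1r in qs.
have s_size : size s = n by move: q_size; rewrite qs size_prod_XsubC => -[].
have qx : q.[x] = \sum_(i < n) (b i - c i) * x ^+ i.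
  transitivity (q.[x] - (x ^+ n + \sum_(i < n) c i * x ^+ i)).
    by rewrite cx subr0.
  under [RHS]eq_bigr => i _ do rewrite mulrBl.
  by rewrite hornerD hornerXn horner_poly sumrB; ring.
have qxe : absv q.[x] < e ^+ n.
  have d0 : 0 < e ^+ n / M by rewrite divr_gt0 // exprn_gt0.
  rewrite qx; elim/big_ind: _ => [|u v un vn|i _].
  - by rewrite absv0 exprn_gt0.
  - by apply: le_lt_trans (absvD _ _) _; rewrite gt_max un.
  rewrite absvM absvX absvBC.
  apply: le_lt_trans (_ : _ <= absv (c i - b i) * M) _; last first.
    by rewrite -ltr_pdivlMr //; case: (bP i).
  rewrite ler_wpM2l ?absv_ge0 // /M; apply: le_trans (_ : (1 + absv x) ^+ i <= _).
    by rewrite lerXn2r ?nnegrE ?absv_ge0 ?addr_ge0 ?ler01 ?absv_ge0 // lerDr.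
  by rewrite ler_weXn2l // ltnW.
apply: contrapT => noroot.
have : e ^+ n <= absv q.[x].
  rewrite qs horner_prod absv_prod -s_size.
  have far : {in s, forall a, e <= absv ('X - a%:P).[x]}.
    move=> a sa; rewrite hornerXsubC leNgt; apply/negP => xa.
    by apply: noroot; exists a => //; exact: Fs.
  elim: s far {Fs qs s_size} => [|a s IH] far; first by rewrite big_nil.
  rewrite big_cons exprS /= ler_pM ?exprn_ge0 ?(ltW e0) //.
    by apply: far; rewrite inE eqxx.
  by apply: IH => u us; apply: far; rewrite inE us orbT.
by rewrite leNgt qxe.
Qed.

End Closure.

Section Intermediate.
Context {R : realType} {k K : analyticFieldType R} (iota : {rmorphism k -> K}).
Hypothesis K_closed : closed_subfield [set: K].
Implicit Types (F : set K).

Definition intermediate F :=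
  [/\ closed_subfield F, range iota `<=` F & lim_closed F].

Lemma interm_predP F : interm_pred iota F <-> intermediate F.
Proof.
split=> [/asboolP[sF kF cF aF]|[[sF aF] kF lF]].
  by split=> //; exact: is_complete_lim_closed.
by apply/asboolP; split=> //; exact: lim_closed_is_complete.
Qed.

Lemma gen_subfieldP S : is_subfield (gen_subfield iota S).
Proof.
apply: is_subfieldI.
- by move=> G [sG _]; exact: subfield1.
- move=> x y Gx Gy G GP.
  by apply: (subfieldB GP.1); [exact: Gx|exact: Gy].
- move=> x y Gx Gy G GP.
  by apply: (subfield_div GP.1); [exact: Gx|exact: Gy].
Qed.

Lemma ta_closureE S :
  ta_closure iota S = adherence (alg_closure (gen_subfield iota S)).
Proof. exact: closure_adherence. Qed.

Lemma sub_gen_subfield S : range iota `|` S `<=` gen_subfield iota S.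
Proof. exact: sub_smallest. Qed.

Lemma gen_sub_ta_closure S : gen_subfield iota S `<=` ta_closure iota S.
Proof.
move=> x gx; rewrite ta_closureE; apply: sub_adherence.
by apply: sub_alg_closure gx; exact: gen_subfieldP.
Qed.

Lemma ta_closure_intermediate S : intermediate (ta_closure iota S).
Proof.
split.
- rewrite ta_closureE; apply: adherence_alg_closed => //.
  by apply: alg_closure_closed => //; exact: gen_subfieldP.
- by move=> x kx; apply: gen_sub_ta_closure; apply: sub_gen_subfield; left.
- by rewrite ta_closureE; exact: adherence_closed.
Qed.

Lemma sub_ta_closure S : S `<=` ta_closure iota S.
Proof. by move=> x Sx; apply: gen_sub_ta_closure; apply: sub_gen_subfield; right. Qed.

(** Each of the three stages (generated subfield, algebraic closure, limits) stays inside an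
    intermediate field. *)
Lemma ta_closure_min S F : intermediate F -> S `<=` F -> ta_closure iota S `<=` F.
Proof.
move=> [cF kF lF] SF.
have gF : gen_subfield iota S `<=` F.
  by apply: smallest_sub; [exact: cF.1|move=> x [/kF|/SF]].
rewrite ta_closureE => x lx; apply: lF; apply: adherence_sub lx => {}x.
move=> [p /(polyOver_coefs_in _ (subfield0 (gen_subfieldP S))) gp [p0 px]].
by apply: alg_closed_root px => // i; apply: gF; exact: gp.
Qed.

Lemma ta_closure_mono S S' : S `<=` S' -> ta_closure iota S `<=` ta_closure iota S'.
Proof.
move=> SS'; apply: ta_closure_min; first exact: ta_closure_intermediate.
by move=> x /SS'; exact: sub_ta_closure.
Qed.

End Intermediate.

(** * Perturbation of roots *)

Section Distance.
Context {R : realType} {K : analyticFieldType R}.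
Implicit Types (x y : K) (F G : set K) (r e : R).

Definition dist x F : R := inf [set absv (x - a) | a in F].

Lemma dist_lbound x F : has_lbound [set absv (x - a) | a in F].
Proof. by exists 0 => _ [a _ <-]; exact: absv_ge0. Qed.

Lemma dist_le x F a : F a -> dist x F <= absv (x - a).
Proof. by move=> Fa; apply: (ge_inf (dist_lbound x F)); exists a. Qed.

Lemma dist_ge x F r : F !=set0 -> (forall a, F a -> r <= absv (x - a)) ->
  r <= dist x F.
Proof.
move=> [a Fa] Fr; apply: lb_le_inf; first by exists (absv (x - a)), a.
by move=> _ [b Fb <-]; exact: Fr.
Qed.

Lemma dist_lt x F r : F !=set0 -> dist x F < r ->
  exists2 a, F a & absv (x - a) < r.
Proof.
move=> F0 Fr; apply: contrapT => nFr.
have : r <= dist x F.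
  by apply: dist_ge => // a Fa; rewrite leNgt; apply/negP => ar; apply: nFr; exists a.
by rewrite leNgt Fr.
Qed.

Lemma dist_gt0 x F : F !=set0 -> lim_closed F -> ~ F x -> 0 < dist x F.
Proof.
move=> F0 lF Fx; rewrite ltNge; apply/negP => d0; apply/Fx/lF => e e0.
exact/(dist_lt F0)/(le_lt_trans d0).
Qed.

Lemma dist_anti x F G : F !=set0 -> F `<=` G -> dist x G <= dist x F.
Proof. by move=> F0 FG; apply: dist_ge => // a /FG; exact: dist_le. Qed.

End Distance.

(** * Gauss norms and the existence of a root near a given point *)

Section Perturbation.
Context {R : realType} {K : analyticFieldType R}.
Hypothesis K_closed : closed_subfield [set: K].
Implicit Types (x y : K) (F : set K) (r e : R).

Lemma split_polyK (p : {poly K}) : p != 0 ->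
  exists s : seq K, p = lead_coef p *: \prod_(a <- s) ('X - a%:P).
Proof. by move=> p0; have [|s _ sP] := alg_closed_split K_closed _ p0; [|exists s]. Qed.

(** Over [F], [q] is a product of linear factors, each of which changes by a relative factor at most
    [th] between [y0] and [y]. The ultrametric inequality preserves this bound under products, and
    [th < 1] then makes the two absolute values equal. *)
Lemma perturb_horner F y0 y (th : R) (q : {poly K}) :
    closed_subfield F -> 0 <= th < 1 ->
    (forall a, F a -> absv (y - y0) <= th * absv (y0 - a)) -> coefs_in F q ->
  absv (q.[y] - q.[y0]) <= th * absv q.[y0] /\ absv q.[y] = absv q.[y0].
Proof.
move=> cF /andP[th0 th1] hy Fq.
suff main : absv (q.[y] - q.[y0]) <= th * absv q.[y0].
  split=> //; have [q0|q0] := eqVneq q.[y0] 0.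
    by move: main; rewrite q0 absv0 mulr0 subr0 absv_le0 => /eqP->; rewrite absv0.
  apply: absv_close; rewrite absvBC; apply: le_lt_trans main _.
  by rewrite gtr_pMl // absv_gt0.
have [->|q0] := eqVneq q 0; first by rewrite !horner0 subrr absv0 mulr0.
have [s Fs ->] := alg_closed_split cF Fq q0.
rewrite !hornerZ -mulrBr !absvM mulrCA ler_wpM2l ?absv_ge0 //.
elim: s Fs {q Fq q0} => [|a s IH] Fs.
  by rewrite big_nil !hornerC subrr absv0 mulr_ge0 ?absv_ge0.
rewrite big_cons !hornerM !hornerXsubC; set p := \prod_(_ <- s) _ in IH *.
have {}IH : absv (p.[y] - p.[y0]) <= th * absv p.[y0].
  by apply: IH => b bs; apply: Fs; rewrite inE bs orbT.
have Fa : F a by apply: Fs; rewrite inE eqxx.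
have py : absv p.[y] <= absv p.[y0].
  rewrite -[p.[y]](subrK p.[y0]); apply: le_trans (absvD _ _) _.
  rewrite ge_max lexx andbT; apply: le_trans IH _.
  by rewrite ler_piMl ?absv_ge0 // ltW.
have -> : (y - a) * p.[y] - (y0 - a) * p.[y0] =
  (y - y0) * p.[y] + (y0 - a) * (p.[y] - p.[y0]) by ring.
apply: le_trans (absvD _ _) _; rewrite ge_max !absvM; apply/andP; split.
  by rewrite mulrA ler_pM ?absv_ge0 // hy.
by rewrite mulrCA ler_wpM2l ?absv_ge0.
Qed.

(** One half of the multiplicativity of the Gauss norm of radius [r], for which ['X - b%:P] has norm
    [Num.max r (absv b)]. *)
Lemma coef_prod_XsubC_le (s : seq K) r i : 0 <= r ->
  absv (\prod_(b <- s) ('X - b%:P))`_i * r ^+ i <=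
  \prod_(b <- s) Num.max r (absv b).
Proof.
move=> r0; elim: s i => [|b s IH] i.
  rewrite !big_nil coefC; case: eqP => [->|_]; first by rewrite absv1 mulr1.
  by rewrite absv0 mul0r ler01.
rewrite !big_cons mulrBl coefB coefXM coefCM; set p := \prod_(_ <- s) _ in IH *.
set M := \prod_(_ <- s) _ in IH *.
have M0 : 0 <= M.
  by apply: le_trans (IH 0%N); rewrite mulr_ge0 ?absv_ge0 ?exprn_ge0.
apply: le_trans (_ : Num.max (absv (if i == 0 then 0 else p`_i.-1))
  (absv (b * p`_i)) * r ^+ i <= _).
  by rewrite ler_wpM2r ?exprn_ge0 // absvB.
rewrite maxr_pMl ?exprn_ge0 // ge_max; apply/andP; split.
  case: i => [|i] /=.
    by rewrite absv0 mul0r mulr_ge0 // le_max r0.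
  by rewrite exprS mulrCA ler_pM ?mulr_ge0 ?absv_ge0 ?exprn_ge0 ?le_max ?lexx.
by rewrite absvM -mulrA ler_pM ?mulr_ge0 ?absv_ge0 ?exprn_ge0 ?le_max ?lexx ?orbT.
Qed.

Lemma comp_XaddC_prod (s : seq K) (a : K) :
  (\prod_(b <- s) ('X - b%:P)) \Po ('X + a%:P) =
  \prod_(b <- [seq b - a | b <- s]) ('X - b%:P).
Proof.
rewrite big_map; elim: s => [|b s IH]; first by rewrite !big_nil comp_polyC.
rewrite !big_cons rmorphM /= IH; congr (_ * _).
by rewrite rmorphB /= comp_polyX comp_polyC polyCB; ring.
Qed.

(* The Gauss norms of [p] and [p0] are compared on the disc with centre [a] and
   radius [absv (x - a)]. *)
Lemma close_poly_value (p p0 : {poly K}) x a (th : R) (s : seq K) :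
    0 <= th -> p = lead_coef p *: \prod_(b <- s) ('X - b%:P) -> p0.[x] = 0 ->
    (forall j, absv ((p \Po ('X + a%:P))`_j - (p0 \Po ('X + a%:P))`_j) <=
               th * absv (p \Po ('X + a%:P))`_j) ->
  absv p.[x] <=
  th * (absv (lead_coef p) * \prod_(b <- s) Num.max (absv (x - a)) (absv (x - b))).
Proof.
move=> th0 ps p0x close; set r := absv (x - a).
have r0 : 0 <= r by exact: absv_ge0.
have -> : p.[x] = ((p - p0) \Po ('X + a%:P)).[x - a].
  by rewrite horner_comp !hornerE subrK p0x subr0.
have mE b : Num.max r (absv (b - a)) = Num.max r (absv (x - b)).
  apply/eqP; rewrite eq_le !ge_max !le_max !lexx /=; apply/andP; split.
    by rewrite -le_max (_ : b - a = (x - a) - (x - b)) ?absvB //; ring.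
  by rewrite -le_max (_ : x - b = (x - a) - (b - a)) ?absvB //; ring.
have PM0 : 0 <= \prod_(b <- s) Num.max r (absv (x - b)).
  by apply: prodr_ge0 => b _; rewrite le_max r0.
rewrite horner_coef; apply: absv_sum => [|[j /= _] _].
  by rewrite !mulr_ge0 ?absv_ge0.
rewrite absvM absvX rmorphB coefB.
apply: le_trans (_ : th * absv (p \Po ('X + a%:P))`_j * r ^+ j <= _).
  by rewrite ler_wpM2r ?exprn_ge0 // close.
rewrite -mulrA ler_wpM2l // ps linearZ /= comp_XaddC_prod coefZ absvM -ps -mulrA.
rewrite ler_wpM2l ?absv_ge0 //; apply: le_trans (coef_prod_XsubC_le _ _ r0) _.
by rewrite big_map; under eq_bigr do rewrite mE.
Qed.

Lemma expr_lt_near1 (c : R) n : 1 < c -> exists2 l, 1 < l & l ^+ n < c.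
Proof.
elim: n c => [|n IH] c c1; first by exists 2; rewrite ?ltr1n ?expr0.
have [l l1 lc] := IH ((1 + c) / 2) ltac:(lra).
exists (Num.min l (c / ((1 + c) / 2))).
  by rewrite lt_min l1 ltr_pdivlMr; lra.
set m := Num.min _ _.
have c0 : 0 < (1 + c) / 2 by lra.
have m0 : 0 < m by rewrite lt_min (lt_trans ltr01) ?divr_gt0; lra.
rewrite exprS; have cE : c = c / ((1 + c) / 2) * ((1 + c) / 2).
  by rewrite divfK // gt_eqF.
rewrite [ltRHS]cE; apply: le_lt_trans (_ : _ <= c / ((1 + c) / 2) * m ^+ n) _.
  by rewrite ler_wpM2r ?exprn_ge0 ?(ltW m0) // ge_min lexx orbT.
rewrite ltr_pM2l; last by rewrite divr_gt0; lra.
apply: le_lt_trans lc; rewrite lerXn2r ?nnegrE ?(ltW m0) //.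
  by rewrite ltW // (lt_trans ltr01).
by rewrite ge_min lexx.
Qed.

(** Suppose that all roots [b] of [p] are at distance at least [dist x F]. For a nearly optimal
    centre [a] in [F], each [Num.max (absv (x - a)) (absv (x - b))] is at most [l * absv (x - b)]
    with [l] close to 1. The Gauss norm estimate then bounds [absv p.[x]] by [th * l ^+ size s]
    times itself, which is absurd. *)
Lemma close_poly_root F (p p0 : {poly K}) x (th : R) :
    F !=set0 -> 0 < dist x F -> 0 <= th < 1 -> p != 0 -> p0.[x] = 0 ->
    (forall a, F a -> forall j,
      absv ((p \Po ('X + a%:P))`_j - (p0 \Po ('X + a%:P))`_j) <=
      th * absv (p \Po ('X + a%:P))`_j) ->
  exists2 b, root p b & absv (x - b) < dist x F.
Proof.
move=> F0 s0 /andP[th0 th1] pn0 p0x close; have [s ps] := split_polyK pn0.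
apply: contrapT => far.
have {}far b : b \in s -> dist x F <= absv (x - b).
  move=> bs; rewrite leNgt; apply/negP => xb; apply: far; exists b => //.
  by rewrite ps rootZ ?lead_coef_eq0 // root_prod_XsubC.
set D := dist x F in s0 far *; pose N := \prod_(b <- s) absv (x - b).
have pxE : absv p.[x] = absv (lead_coef p) * N.
  rewrite [in LHS]ps hornerZ absvM horner_prod absv_prod /N; congr (_ * _).
  by apply: eq_bigr => b _; rewrite hornerXsubC.
have N0 : 0 < N.
  rewrite /N; elim: s far {ps N pxE} => [|b s IH] far; first by rewrite big_nil.
  rewrite big_cons mulr_gt0 ?IH //.
    by apply: lt_le_trans s0 _; apply: far; rewrite inE eqxx.
  by move=> c cs; apply: far; rewrite inE cs orbT.
(* Since [th < 1], the number [2 / (1 + th)] exceeds 1, while [th * (2 / (1 + th))] is still below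
   1. *)
have [|l l1 lth] := @expr_lt_near1 (2 / (1 + th)) (size s).
  by rewrite ltr_pdivlMr; lra.
have l0 : 0 < l by apply: lt_trans l1.
have [||a Fa xa] := @dist_lt _ _ x F (D * l) => //.
  by rewrite ltr_pMr.
have M_le : \prod_(b <- s) Num.max (absv (x - a)) (absv (x - b)) <=
            l ^+ size s * N.
  rewrite /N; elim: s far {ps N pxE N0 lth} => [|b s IH] far.
    by rewrite !big_nil mulr1.
  have Db : D <= absv (x - b) by apply: far; rewrite inE eqxx.
  rewrite !big_cons /= exprS mulrACA ler_pM //.
  - by rewrite le_max absv_ge0.
  - by apply: prodr_ge0 => c _; rewrite le_max absv_ge0.
  - rewrite ge_max; apply/andP; split.
      by apply: le_trans (ltW xa) _; rewrite mulrC ler_wpM2l // ltW.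
    by rewrite ler_peMl ?absv_ge0 // ltW.
  - by apply: IH => c cs; apply: far; rewrite inE cs orbT.
have := close_poly_value th0 ps p0x (close a Fa).
have lc0 : 0 < absv (lead_coef p) by rewrite absv_gt0 lead_coef_eq0.
rewrite pxE mulrCA ler_pM2l // => NM.
have : N <= th * (2 / (1 + th)) * N.
  apply: le_trans NM _; rewrite -mulrA ler_wpM2l //; apply: le_trans M_le _.
  by rewrite ler_wpM2r ?(ltW N0) // ltW.
apply/negP; rewrite -ltNge gtr_pMl //.
by rewrite mulrA ltr_pdivrMr; lra.
Qed.

(** After recentring at [a], each coefficient of [W.[y%:P]] is the value at [y] of a fixed
    polynomial; when [W] and [a] are over [F] so is that polynomial, and [perturb_horner] applies to
    it. *)
Lemma coef_horner_comp (W : {poly {poly K}}) a y j :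
  (W.[y%:P] \Po ('X + a%:P))`_j =
  (\poly_(i < size W) (W`_i \Po ('X + a%:P))`_j).[y].
Proof.
rewrite horner_coef horner_poly rmorph_sum /= coef_sum; apply: eq_bigr => i _.
by rewrite rmorphM /= -polyC_exp comp_polyC coefMC.
Qed.

(** With [th = absv (y - y0) / dist y0 F < 1], passing from [y0] to [y] changes every coefficient by
    a relative factor at most [th], so [close_poly_root] compares [W.[y%:P]] with [W.[y0%:P]], which
    vanishes at [x]. If [W.[y%:P]] were 0, a nonzero polynomial over [F] would vanish at [y], hence
    at [y0], putting [y0] in [F]. *)
Lemma correspondence_root F (W : {poly {poly K}}) x y0 y :
    closed_subfield F -> lim_closed F -> (forall i, coefs_in F W`_i) -> W != 0 ->
    ~ F x -> ~ F y0 -> W.[y0%:P].[x] = 0 -> absv (y - y0) < dist y0 F ->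
  W.[y%:P] != 0 /\ exists2 b, root W.[y%:P] b & absv (x - b) < dist x F.
Proof.
move=> cF lF FW W0 nFx nFy0 Wx yy0; have sF := cF.1.
have F0 : F !=set0 by exists 0; exact: subfield0.
have t0 := dist_gt0 F0 lF nFy0.
pose th := absv (y - y0) / dist y0 F.
have th01 : 0 <= th < 1.
  by rewrite divr_ge0 ?absv_ge0 ?(ltW t0) //= ltr_pdivrMr // mul1r.
have hy a : F a -> absv (y - y0) <= th * absv (y0 - a).
  move=> Fa; rewrite /th mulrAC ler_pdivlMr //.
  by rewrite ler_wpM2l ?absv_ge0 // dist_le.
have FQ a j : F a ->
    coefs_in F (\poly_(i < size W) (W`_i \Po ('X + a%:P))`_j).
  move=> Fa i; rewrite coef_poly; case: ifP => _; last exact: subfield0.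
  apply: coefs_in_comp => //; apply: coefs_inD => //; first exact: coefs_inX.
  exact: coefs_inC.
have close a : F a -> forall j,
    absv ((W.[y%:P] \Po ('X + a%:P))`_j - (W.[y0%:P] \Po ('X + a%:P))`_j) <=
    th * absv (W.[y%:P] \Po ('X + a%:P))`_j.
  move=> Fa j; rewrite !coef_horner_comp.
  by have [? ->] := perturb_horner cF th01 hy (FQ a j Fa).
have Wy0 : W.[y%:P] != 0.
  apply/eqP => WE; have [i Wi] : exists i, W`_i != 0.
    by exists (size W).-1; rewrite -lead_coefE lead_coef_eq0.
  have [j Wij] : exists j, W`_i`_j != 0.
    by exists (size W`_i).-1; rewrite -lead_coefE lead_coef_eq0.
  set Q := \poly_(i < size W) W`_i`_j.
  have FQ0 : coefs_in F Q.
    by move=> l; rewrite coef_poly; case: ifP => _; [exact: FW|exact: subfield0].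
  have Q0 : Q != 0.
    apply: contraNneq Wij => /polyP/(_ i); rewrite coef_poly coef0.
    by case: ltnP => [_ ->//|Wi' _]; rewrite (nth_default 0 Wi') coef0.
  have Qy : Q.[y] = 0.
    have := congr1 (fun p : {poly K} => p`_j) WE.
    rewrite coef0 horner_coef coef_sum /Q horner_poly => WE0; rewrite -[RHS]WE0.
    by apply: eq_bigr => l _; rewrite -polyC_exp coefMC.
  have [_] := perturb_horner cF th01 hy FQ0.
  rewrite Qy absv0 => /esym/eqP; rewrite absv_eq0 => Qy0.
  exact/nFy0/(alg_closed_root cF FQ0 Q0).
by split=> //; apply: close_poly_root th01 _ Wx close => //; exact: dist_gt0.
Qed.

End Perturbation.

(** * The chain of intermediate fields *)

Section ValueGroup.
Context {R : realType} {K : analyticFieldType R}.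
Implicit Types (F : set K) (a b c : R).

(** Bernoulli's inequality [n (c - 1) <= c ^+ n]. *)
Lemma expr_gt_bound (c B : R) : 1 < c -> exists n, B < c ^+ n.
Proof.
move=> c1; have c0 : 0 < c - 1 by rewrite subr_gt0.
exists (Num.truncn (B / (c - 1))).+1; set n := _.+1.
apply: lt_le_trans (_ : n%:R * (c - 1) <= _).
  by rewrite -ltr_pdivrMr // truncnS_gt.
elim: n => [|n IH]; first by rewrite mul0r expr0 ler01.
rewrite exprS -natr1 mulrDl mul1r.
have cn : 1 <= c ^+ n by rewrite exprn_ege1 // ltW.
have -> : c * c ^+ n = c ^+ n + (c - 1) * c ^+ n by ring.
by rewrite lerD // ler_peMr // ltW.
Qed.

(** An [n]-th root [f] of [e] lies in [F] and satisfies [1 < absv f < b / a] for large [n]; the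
    integral powers of [f] then advance by steps too small to jump over the interval from [a] to
    [b]. *)
Lemma value_dense F e a b : closed_subfield F -> F e -> 1 < absv e ->
  0 < a -> a < b -> exists2 c : K, F c & a < absv c < b.
Proof.
move=> [sF aF] Fe e1 a0 ab; have ab1 : 1 < b / a by rewrite ltr_pdivlMr // mul1r.
have [n en] := expr_gt_bound (absv e) ab1.
have n0 : (0 < n)%N.
  by case: n en => //; rewrite expr0 => /(lt_trans e1); rewrite ltxx.
pose p : {poly K} := 'X^n - e%:P.
have [||f Ff] := aF p.
- apply/(polyOver_coefs_in _ (subfield0 sF)) => i.
  rewrite coefB coefXn coefC; apply: (subfieldB sF).
    by case: eqP => _; [exact: subfield1|exact: subfield0].
  by case: eqP => _; [|exact: subfield0].
- by rewrite size_XnsubC.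
rewrite /root !hornerE subr_eq0 => /eqP fe.
have f1 : 1 < absv f.
  rewrite ltNge; apply/negP => f1; move: e1; rewrite -fe absvX ltNge.
  by rewrite exprn_ile1 ?absv_ge0.
have fab : absv f < b / a.
  rewrite -(ltr_pXn2r n0) ?nnegrE ?absv_ge0 ?divr_ge0 ?(ltW a0) ?(ltW (lt_trans a0 ab)) //.
  by rewrite -absvX fe.
have f0 : 0 < absv f by apply: lt_trans f1.
have [N aN] := expr_gt_bound a f1.
have [m am] := expr_gt_bound a^-1 f1.
pose P j := a < absv (f ^+ j / f ^+ m).
have exP : exists j, P j.
  exists (N + m)%N; rewrite /P exprD mulfK ?absvX //.
  by rewrite expf_neq0 // -absv_gt0.
have [j Pj jmin] := ex_minnP exP; exists (f ^+ j / f ^+ m).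
  by apply: (subfield_div sF); exact: subfieldX.
(* The choice of [m] rules out [j = 0]. Otherwise the preceding power is at most [a] by minimality,
   and one more factor [f] keeps it below [b]. *)
rewrite [X in X && _]Pj /=; case: j Pj jmin => [|j] Pj jmin.
  move: Pj; rewrite /P expr0 div1r absvV absvX ltNge.
  by rewrite -[a]invrK lef_pV2 ?posrE ?invr_gt0 ?exprn_gt0 // ltW.
have : absv (f ^+ j / f ^+ m) <= a.
  by rewrite leNgt; apply/negP => /jmin; rewrite ltnn.
rewrite exprS -mulrA [absv (f * _)]absvM => za.
apply: le_lt_trans (_ : _ <= absv f * a) _; first by rewrite ler_wpM2l // ltW.
by rewrite -ltr_pdivlMr.
Qed.

End ValueGroup.

(** * Strict monotonicity of the distance along the chain *)

Section Chain.
Context {R : realType} {k K : analyticFieldType R} (iota : {rmorphism k -> K}).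
Hypothesis K_closed : closed_subfield [set: K].
Implicit Types (x y : K) (F G E : set K).

Local Notation ta x := (ta_closure iota [set x]).
Local Notation interm := (intermediate iota).

Lemma interm_nonempty F : interm F -> F !=set0.
Proof. by move=> [[sF _] _ _]; exists 0; exact: subfield0. Qed.

Lemma ta_self x : ta x x. Proof. exact: sub_ta_closure. Qed.
Arguments ta_self : clear implicits.

Lemma ta_sub x F : interm F -> F x -> ta x `<=` F.
Proof. by move=> iF Fx; apply: ta_closure_min => // _ ->. Qed.

Lemma ta_interm x : interm (ta x).
Proof. exact: ta_closure_intermediate. Qed.

Lemma gen_subfield1 F x z : is_subfield F -> range iota `<=` F ->
  gen_subfield iota [set x] z ->
  exists u v, [/\ coefs_in F u, coefs_in F v, v.[x] != 0 & z = u.[x] / v.[x]].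
Proof.
move=> sF kF; pose L : set K := [set z | exists u v,
  [/\ coefs_in F u, coefs_in F v, v.[x] != 0 & z = u.[x] / v.[x]]].
suff : gen_subfield iota [set x] `<=` L by apply.
have FC c : F c -> coefs_in F c%:P by move=> Fc; exact: coefs_inC.
have F1 : coefs_in F 1 by apply: FC; exact: subfield1.
apply: smallest_sub; last first.
  move=> _ [[c _ <-]|->].
    exists (iota c)%:P, 1; split=> //; first by apply: FC; apply: kF; exists c.
      by rewrite hornerC oner_neq0.
    by rewrite !hornerC divr1.
  exists 'X, 1; split=> //; first exact: coefs_inX.
    by rewrite hornerC oner_neq0.
  by rewrite hornerX hornerC divr1.
apply: is_subfieldI.
- by exists 1, 1; split=> //; rewrite hornerC ?oner_neq0 ?divr1.
- move=> _ _ [u [v [Fu Fv v0 ->]]] [u' [v' [Fu' Fv' v0' ->]]].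
  exists (u * v' - u' * v), (v * v'); split.
  + by apply: coefs_inB => //; exact: coefs_inM.
  + exact: coefs_inM.
  + by rewrite hornerM mulf_neq0.
  + by rewrite !hornerE; field; rewrite v0 v0'.
- move=> _ _ [u [v [Fu Fv v0 ->]]] [u' [v' [Fu' Fv' v0' ->]]].
  (* Division by 0 yields 0, which is represented as [0 / 1]. *)
  have [u0'|u0'] := eqVneq u'.[x] 0.
    exists 0, 1; split=> //; first by apply: FC; exact: subfield0.
      by rewrite hornerC oner_neq0.
    by rewrite u0' mul0r invr0 mulr0 horner0 mul0r.
  exists (u * v'), (v * u'); split; try exact: coefs_inM.
    by rewrite hornerM mulf_neq0.
  by rewrite !hornerE; field; rewrite v0 v0' u0'.
Qed.

(** The denominators are cleared in an equation for [y] over the field generated by [x]: the outer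
    variable of [W] stands for [y], the inner one for [x]. *)
Lemma algebraic_correspondence F x y : is_subfield F -> range iota `<=` F ->
  alg_closure (gen_subfield iota [set x]) y ->
  exists W : {poly {poly K}},
    [/\ forall i, coefs_in F W`_i, W != 0 & W.[y%:P].[x] = 0].
Proof.
move=> sF kF [p /(polyOver_coefs_in _ (subfield0 (gen_subfieldP _ _))) gp [p0 py]].
have /choice[uv uvP] i : exists uv : {poly K} * {poly K},
    [/\ coefs_in F uv.1, coefs_in F uv.2, uv.2.[x] != 0 & p`_i = uv.1.[x] / uv.2.[x]].
  by have [u [v uvP]] := gen_subfield1 sF kF (gp i); exists (u, v).
pose n := size p; pose D := \prod_(i < n) (uv i).2.[x].
have D0 : D != 0 by apply/prodf_neq0 => i _; case: (uvP i).
pose w i := (uv i).1 * \prod_(j < n | j != i :> nat) (uv j).2.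
have Fw i : coefs_in F (w i).
  apply: coefs_inM => //; first by case: (uvP i).
  elim/big_ind: _ => [|q r|j _]; [|exact: coefs_inM|by case: (uvP j)].
  by apply: coefs_inC => //; exact: subfield1.
have wx i : (i < n)%N -> (w i).[x] = D * p`_i.
  move=> ltin; rewrite /w hornerM horner_prod /D [in RHS](bigD1 (Ordinal ltin)) //=.
  have [_ _ v0 ->] := uvP i.
  rewrite (eq_bigl (fun j : 'I_n => j != Ordinal ltin)) //.
  by field.
exists (\poly_(i < n) w i); split.
- move=> i; rewrite coef_poly; case: ifP => _ //.
  by move=> j; rewrite coef0; exact: subfield0.
- have nn : (n.-1 < n)%N by rewrite prednK ?size_poly_gt0.
  apply/eqP => /polyP/(_ n.-1); rewrite coef_poly nn coef0.
  move=> /(congr1 (horner^~ x)); rewrite /= wx // horner0 => /eqP.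
  by rewrite mulf_eq0 (negbTE D0) /= -lead_coefE lead_coef_eq0 (negbTE p0).
- rewrite horner_poly horner_sum.
  rewrite (eq_bigr (fun i : 'I_n => D * (p`_i * y ^+ i))).
    by rewrite -mulr_sumr -horner_coef (rootP py) mulr0.
  by move=> i _; rewrite hornerM -polyC_exp hornerC wx // mulrA.
Qed.

(** An element [y0] algebraic over the field generated by [x], with [absv (y - y0) < dist y F], has
    the same distances as [y] to the points of [F]. The root [b] of [W.[y%:P]] near [x] lies in [G],
    as the coefficients do. *)
Lemma dist_ta_lt F G x y : interm F -> interm G -> F `<=` G -> ~ F x ->
  G y -> ~ F y -> ta x y -> dist x G < dist x F.
Proof.
move=> iF iG FG nFx Gy nFy; have [cF kF lF] := iF; have F0 := interm_nonempty iF.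
rewrite ta_closureE => /(_ _ (dist_gt0 F0 lF nFy))[y0 Ay0 yy0].
have [W [FW W0 Wx]] := algebraic_correspondence cF.1 kF Ay0.
have close a : F a -> absv (y0 - a) = absv (y - a).
  move=> Fa; rewrite -[y0 - a](subrKA y) addrC [LHS]absv_addl //.
  by rewrite absvBC; apply: lt_le_trans yy0 _; exact: dist_le.
have nFy0 : ~ F y0.
  by move=> Fy0; move: yy0; rewrite ltNge dist_le.
have yy0' : absv (y - y0) < dist y0 F.
  apply: lt_le_trans yy0 _; apply: dist_ge => // a Fa.
  by rewrite close //; exact: dist_le.
have [Wy0 [b Wb xb]] := correspondence_root K_closed cF lF FW W0 nFx nFy0 Wx yy0'.
apply: le_lt_trans xb; apply: dist_le.
have [cG _ _] := iG; apply: (alg_closed_root cG _ Wy0 Wb).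
rewrite horner_coef => i; rewrite coef_sum; apply: (subfield_sum cG.1) => j _.
rewrite -polyC_exp coefMC; apply: (subfieldM cG.1); first exact/FG/FW.
exact: (subfieldX cG.1).
Qed.

Hypothesis ta_total : forall x y, ta x y \/ ta y x.

Lemma interm_total F G : interm F -> interm G -> F `<=` G \/ G `<=` F.
Proof.
move=> iF iG; have [|/existsNP[x /not_implyP[Fx nGx]]] := pselect (F `<=` G).
  by left.
right=> y Gy; have [/(ta_sub iF Fx)//|yx] := ta_total x y.
by case: nGx; exact: (ta_sub iG Gy).
Qed.

Lemma interm_sub_ta F x : interm F -> ~ F x -> F `<=` ta x.
Proof.
move=> iF nFx; have [//|xF] := interm_total iF (ta_interm x).
by case: nFx; apply: xF; exact: ta_self.
Qed.

Lemma dist_lt_interm F G x y : interm F -> interm G -> F `<=` G -> ~ G x ->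
  G y -> ~ F y -> dist x G < dist x F.
Proof.
move=> iF iG FG nGx Gy nFy; apply: (dist_ta_lt iF iG FG _ Gy nFy).
  by move/FG.
exact: interm_sub_ta Gy.
Qed.

(** If the absolute value were trivial on [ta x], then every [w'] outside it would satisfy
    [dist w' (ta x) < dist w' F <= absv w'], so some [e] in [ta x] would have
    [absv (w' - e) < absv w' = absv e = 1]. But [w - e] is again outside [ta x], so its absolute
    value would be 1 as well. *)
Lemma ta_value_gt1 F x w : interm F -> ~ F x -> ~ ta x w ->
  exists2 e, ta x e & 1 < absv e.
Proof.
move=> iF nFx nEw; apply: contrapT => small.
have [cE _ _] := ta_interm x; have sE := cE.1.
have E1 e : ta x e -> e != 0 -> absv e = 1.
  move=> Ee e0; apply/eqP; rewrite eq_le leNgt [1 <= _]leNgt.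
  apply/andP; split; apply/negP => e1; apply: small; first by exists e.
  exists e^-1; first exact: (subfieldV sE).
  by rewrite absvV invf_gt1 ?absv_gt0.
have out w' : ~ ta x w' -> exists2 e, ta x e & absv (w' - e) < absv w' /\ absv w' = 1.
  move=> nEw'; have FE := interm_sub_ta iF nFx.
  have lt1 := dist_lt_interm iF (ta_interm x) FE nEw' (ta_self x) nFx.
  have [|e Ee we] := @dist_lt _ _ w' (ta x) (absv w') (interm_nonempty (ta_interm x)).
    apply: lt_le_trans lt1 _; rewrite -[leRHS](congr1 absv (subr0 w')).
    by apply: dist_le; case: iF => -[sF _] _ _; exact: subfield0.
  exists e => //; split=> //; rewrite -(absv_close we) E1 //.
  by rewrite -absv_gt0 (absv_close we); apply: le_lt_trans we; exact: absv_ge0.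
have [e Ee [we w1]] := out w nEw.
have nEwe : ~ ta x (w - e).
  by move=> Ewe; apply: nEw; rewrite -(subrK e w); exact: (subfieldD sE).
have [_ _ [_ we1]] := out _ nEwe.
by move: we; rewrite we1 w1 ltxx.
Qed.

End Chain.
Arguments ta_self {R k K} iota x B _.

(** * What the two degree hypotheses say about fields with one generator *)

Section TopologicalDegree.
Context {R : realType} {k K : analyticFieldType R} (iota : {rmorphism k -> K}).
Hypothesis K_closed : closed_subfield [set: K].

(** For [x != y] the pair is too large to be independent, so a proper subset [S'] has the same
    closure; it is contained in one of the two singletons. *)
Lemma trc1_ta_total : is_trc iota `I_1 -> forall x y,
  ta_closure iota [set x] y \/ ta_closure iota [set y] x.
Proof.
move=> [trc _] x y; have [->|xy] := eqVneq x y; first by left; exact: sub_ta_closure.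
have dep : ~ ta_independent iota [set x; y].
  move=> /trc/pcard_leP/unsquash f.
  have fx : f x = 0%N.
    have : `I_1 (f x) by apply: (@funS _ _ _ _ f x); left.
    by rewrite /= ltnS leqn0 => /eqP.
  have fy : f y = 0%N.
    have : `I_1 (f y) by apply: (@funS _ _ _ _ f y); right.
    by rewrite /= ltnS leqn0 => /eqP.
  have xS : x \in [set x; y] by apply/mem_set; left.
  have yS : y \in [set x; y] by apply/mem_set; right.
  by move/eqP: xy; apply; apply: (@inj _ _ _ f) => //; exact: (etrans fx (esym fy)).
move/existsNP: dep => [S' /not_implyP[[S'S SS'] nlt]].
have SsubS' : ta_closure iota [set x; y] `<=` ta_closure iota S'.
  apply: contrapT => nsub; apply: nlt; split=> //; exact: ta_closure_mono.
have [S'x|nS'x] := pselect (S' x).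
  left; apply: (ta_closure_mono K_closed (S := S')).
    move=> z S'z; have [//|zy] := S'S z S'z; case: SS' => u [->//|->].
    by rewrite -zy.
  by apply: SsubS'; apply: sub_ta_closure => //; right.
right; apply: (ta_closure_mono K_closed (S := S')).
  by move=> z S'z; have [zx|//] := S'S z S'z; case: nS'x; rewrite -zx.
by apply: SsubS'; apply: sub_ta_closure => //; left.
Qed.

(** Otherwise [[set x]] would be t.a. generating, and Tr.c would be finite. *)
Lemma large_ta_proper : large_ext iota -> forall x,
  exists w, ~ ta_closure iota [set x] w.
Proof.
move=> [c [_ cmin] cinf] x; apply: contrapT => /forallNP all_in.
have gen : ta_generating iota [set x].
  rewrite /ta_generating closure_adherence; apply/seteqP; split=> y _.
    exact: contrapT (all_in y).
  apply: sub_adherence; have [_ aK] := K_closed.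
  exists ('X - y%:P); last by rewrite polyXsubC_eq0 root_XsubC.
  by apply/polyOver_coefs_in.
by apply: cinf; apply: card_le_finite (cmin _ gen) _.
Qed.

End TopologicalDegree.

(** * Uniqueness of extensions of absolute values *)

(* Polynomials of degree less than the degree of [al] form a complete normed
   space of finite dimension, on which [absv] of the values at [al] and at [be]
   are hence comparable; taking powers, they are equal. *)
Section UniqueExtension.
Context {R : realType} {K : analyticFieldType R} {L : fieldType}.
Context (i1 i2 : {rmorphism L -> K}).
Hypothesis i12 : forall a, absv (i1 a) = absv (i2 a).
Hypothesis L_closed : lim_closed (range i1).
Hypothesis K_closed : closed_subfield [set: K].
Implicit Types (p q : {poly L}) (al be : K).

Definition values_lt_deg al d : set K :=
  [set (map_poly i1 q).[al] | q in [set q : {poly L} | (size q <= d)%N]].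

Lemma poly_split_lead q d : (size q <= d.+1)%N ->
  exists2 r : {poly L}, (size r <= d)%N & q = r + q`_d *: 'X^d.
Proof.
move=> qd; exists (q - q`_d *: 'X^d); last by rewrite subrK.
apply/leq_sizeP => j dj; rewrite coefB coefZ coefXn.
have [->|jd] := eqVneq j d; first by rewrite mulr1 subrr.
rewrite mulr0 subr0 nth_default //; apply: leq_trans qd _.
by rewrite ltn_neqAle eq_sym jd.
Qed.

Lemma horner_map_lead (i : {rmorphism L -> K}) (r : {poly L}) (l : L) d al :
  (map_poly i (r + l *: 'X^d)).[al] = (map_poly i r).[al] + i l * al ^+ d.
Proof. by rewrite rmorphD /= hornerD map_polyZ map_polyXn hornerZ hornerXn. Qed.

(** Induction on [d]: the values of degree less than [d] form a closed space avoiding [al ^+ d],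
    hence at positive distance [del] from it. This controls the leading coefficient, and the
    induction hypothesis controls the others. For closedness, leading coefficients along a
    convergent sequence are Cauchy, so they converge in [range i1]. *)
Lemma values_lower_bound al d :
    (forall q, q != 0 -> (size q <= d)%N -> (map_poly i1 q).[al] != 0) ->
  lim_closed (values_lt_deg al d) /\
  exists2 c : R, 0 < c & forall q, (size q <= d)%N ->
    forall i, c * absv (i1 q`_i) <= absv (map_poly i1 q).[al].
Proof.
elim: d => [|d IH] free.
  split.
    move=> x lx; exists 0; first by rewrite /= size_poly0.
    rewrite rmorph0 horner0; apply/eqP; rewrite eq_sym -absv_le0 leNgt.
    apply/negP => x0; have [_ [q /= q0 <-]] := lx _ x0.
    move: q0; rewrite leqn0 size_poly_eq0 => /eqP->.
    by rewrite rmorph0 horner0 subr0 ltxx.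
  exists 1 => // q; rewrite leqn0 size_poly_eq0 => /eqP-> i.
  by rewrite coef0 !rmorph0 horner0 absv0 mulr0.
have [|Vcl [c c0 cP]] := IH; first by move=> q q0 qd; exact: free q0 (leqW qd).
set V := values_lt_deg al d in Vcl.
have V0 : V !=set0 by exists (map_poly i1 0).[al], 0 => //=; rewrite size_poly0.
have nVd : ~ V (al ^+ d).
  move=> [r rd rE]; have := free ('X^d - r); rewrite rmorphB /= map_polyXn.
  rewrite hornerD hornerN hornerXn rE subrr eqxx => H.
  have : size ('X^d - r) = d.+1.
    by rewrite size_polyDl size_polyXn // size_polyN ltnS.
  move=> sz; suff: false by [].
  by apply: H; rewrite ?sz // -size_poly_gt0 sz.
have del0 := dist_gt0 V0 Vcl nVd; set del := dist _ _ in del0.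
have lead (r : {poly L}) l : (size r <= d)%N ->
    del * absv (i1 l) <= absv (map_poly i1 (r + l *: 'X^d)).[al].
  move=> rd; rewrite horner_map_lead.
  have [->|l0] := eqVneq l 0; first by rewrite rmorph0 absv0 mulr0 absv_ge0.
  have -> : (map_poly i1 r).[al] + i1 l * al ^+ d =
      (al ^+ d - (map_poly i1 (- l^-1 *: r)).[al]) * i1 l.
    rewrite map_polyZ hornerZ rmorphN fmorphV; field.
    by rewrite fmorph_eq0.
  rewrite absvM ler_wpM2r ?absv_ge0 //; apply: dist_le.
  exists (- l^-1 *: r) => //=; apply: leq_trans (size_scale_leq _ _) rd.
split.
  move=> x /adherence_seq[u [uV ux]].
  have /choice[rl rlP] n : exists rl : {poly L} * L,
      (size rl.1 <= d)%N /\ (map_poly i1 (rl.1 + rl.2 *: 'X^d)).[al] = u n.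
    have [q qd <-] := uV n; have [r rd ->] := poly_split_lead qd.
    by exists (r, q`_d).
  have lC : abs_cauchy (fun n => i1 (rl n).2).
    move=> e e0; have [N uN] := abs_lim_cauchy ux (mulr_gt0 del0 e0).
    exists N => m n Nm Nn; rewrite -rmorphB -(ltr_pM2l del0).
    apply: le_lt_trans (uN m n Nm Nn).
    have [rm <-] := rlP m; have [rn <-] := rlP n.
    have -> : (map_poly i1 ((rl m).1 + (rl m).2 *: 'X^d)).[al] -
        (map_poly i1 ((rl n).1 + (rl n).2 *: 'X^d)).[al] =
        (map_poly i1 (((rl m).1 - (rl n).1) + ((rl m).2 - (rl n).2) *: 'X^d)).[al].
      by rewrite !horner_map_lead !rmorphB hornerD hornerN /=; ring.
    apply: lead; apply: leq_trans (size_polyD _ _) _.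
    by rewrite size_polyN geq_max rm rn.
  have [y yl] := abs_cauchy_cvg lC.
  have [l _ lE] : range i1 y.
    by apply: L_closed; apply: lim_point yl => n; exists (rl n).2.
  have /Vcl[r rd rE] : adherence V (x - i1 l * al ^+ d).
    move=> e e0; have [N1 N1P] := ux e e0.
    have a0 : 0 < absv (al ^+ d) + 1 by rewrite ltr_wpDl ?absv_ge0.
    have [N2 N2P] := yl (e / (absv (al ^+ d) + 1)) (divr_gt0 e0 a0).
    set n := maxn N1 N2; have [rn un] := rlP n.
    exists (map_poly i1 (rl n).1).[al]; first by exists (rl n).1.
    have -> : x - i1 l * al ^+ d - (map_poly i1 (rl n).1).[al] =
        (x - u n) - (y - i1 (rl n).2) * al ^+ d.
      by rewrite -un horner_map_lead lE; ring.
    apply: le_lt_trans (absvB _ _) _; rewrite gt_max N1P ?leq_maxl //=.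
    have := N2P n (leq_maxr _ _); rewrite ltr_pdivlMr // absvM.
    by apply: le_lt_trans; rewrite ler_wpM2l ?absv_ge0 // lerDl.
  exists (r + l *: 'X^d); last by rewrite horner_map_lead rE subrK.
  apply: leq_trans (size_polyD _ _) _; rewrite geq_max (leqW rd) /=.
  by apply: leq_trans (size_scale_leq _ _) _; rewrite size_polyXn.
(* Removing the leading term from [q] multiplies the absolute value at [al] by at most [M], since
   the leading coefficient is at most [absv (map_poly i1 q).[al] / del]. *)
pose M := 1 + absv (al ^+ d) / del.
have M1 : 1 <= M by rewrite lerDl divr_ge0 ?absv_ge0 ?ltW.
have M0 : 0 < M by apply: lt_le_trans M1.
exists (Num.min del (c / M)); first by rewrite lt_min del0 divr_gt0.
move=> q qd i; have [r rd qE] := poly_split_lead qd.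
have [id|id] := leqP d i; last first.
  have ri : q`_i = r`_i.
    by rewrite qE coefD coefZ coefXn (ltn_eqF id) mulr0 addr0.
  apply: le_trans (_ : c / M * absv (i1 q`_i) <= _).
    by rewrite ler_wpM2r ?absv_ge0 // ge_min lexx orbT.
  rewrite mulrAC ler_pdivrMr // ri; apply: le_trans (cP r rd i) _.
  have lq := lead r q`_d rd; rewrite -qE in lq.
  have -> : (map_poly i1 r).[al] = (map_poly i1 q).[al] - i1 q`_d * al ^+ d.
    by rewrite [in RHS]qE horner_map_lead -qE addrK.
  apply: le_trans (absvB _ _) _; rewrite ge_max ler_peMr ?absv_ge0 //=.
  rewrite absvM /M mulrDr mulr1; apply: ler_wpDl; first exact: absv_ge0.
  rewrite mulrA mulrAC ler_wpM2r ?absv_ge0 // ler_pdivlMr //.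
  by rewrite mulrC.
have [->|id'] := eqVneq i d.
  apply: le_trans (_ : del * absv (i1 q`_d) <= _).
    by rewrite ler_wpM2r ?absv_ge0 // ge_min lexx.
  by rewrite [in leRHS]qE; exact: lead.
rewrite nth_default; first by rewrite rmorph0 absv0 mulr0 absv_ge0.
by apply: leq_trans qd _; rewrite ltn_neqAle eq_sym id'.
Qed.

Lemma unique_extension al : algebraicOver i1 al ->
  exists be, forall q, absv (map_poly i1 q).[al] = absv (map_poly i2 q).[be].
Proof.
move=> algal.
have exn : exists n, `[< exists2 p : {poly L}, p != 0 /\ size p = n & root (map_poly i1 p) al >].
  by have [p p0 pal] := algal; exists (size p); apply/asboolP; exists p.
have [n /asboolP[p [p0 pn] pal] nmin] := ex_minnP exn.
have free (q : {poly L}) : q != 0 -> (map_poly i1 q).[al] = 0 -> (size p <= size q)%N.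
  by move=> q0 qal; rewrite pn; apply: nmin; apply/asboolP; exists q => //; exact/rootP.
have p1 : (1 < size p)%N.
  rewrite ltnNge; apply/negP => /size1_polyC pE; move: pal p0.
  rewrite pE map_polyC rootC fmorph_eq0 => /eqP->.
  by rewrite eqxx.
have [||be _ /rootP pbe] := K_closed.2 (map_poly i2 p).
- by apply/polyOver_coefs_in.
- by rewrite size_map_poly.
exists be; pose N1 q := absv (map_poly i1 q).[al].
pose N2 q := absv (map_poly i2 q).[be].
suff : forall q, N1 q = N2 q by [].
have N1M q r : N1 (q * r) = N1 q * N1 r by rewrite /N1 rmorphM hornerM absvM.
have N2M q r : N2 (q * r) = N2 q * N2 r by rewrite /N2 rmorphM hornerM absvM.
have N10 q : 0 <= N1 q by exact: absv_ge0.
have N20 q : 0 <= N2 q by exact: absv_ge0.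
have [|_ [c c0 cP]] := @values_lower_bound al (size p).-1.
  move=> q q0 qd; apply/eqP => /(free _ q0); rewrite leqNgt; apply/negP/negPn.
  by apply: leq_ltn_trans qd _; rewrite prednK // ltnW.
pose M := (1 + absv be) ^+ size p / c.
have be1 : 1 <= 1 + absv be by rewrite lerDl absv_ge0.
have M0 : 0 < M by rewrite divr_gt0 // exprn_gt0 // (lt_le_trans ltr01).
have N2_small q : (size q <= (size p).-1)%N -> N2 q <= M * N1 q.
  move=> qp; rewrite /N2 horner_coef; apply: absv_sum.
    by rewrite mulr_ge0 // ltW.
  case=> j /=; rewrite size_map_poly => jq _.
  rewrite coef_map /= absvM absvX -i12 /M.
  have -> : (1 + absv be) ^+ size p / c * N1 q = N1 q / c * (1 + absv be) ^+ size p.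
    by ring.
  apply: ler_pM; rewrite ?exprn_ge0 ?absv_ge0 //.
    by rewrite ler_pdivlMr // mulrC; exact: cP.
  apply: le_trans (_ : (1 + absv be) ^+ j <= _).
    by rewrite lerXn2r ?nnegrE ?addr_ge0 ?absv_ge0 // lerDr.
  apply: ler_weXn2l => //; apply: leq_trans (ltnW jq) _.
  exact: leq_trans qp (leq_pred _).
have N1p : N1 p = 0 by rewrite /N1 (rootP pal) absv0.
have N2p : N2 p = 0 by rewrite /N2 pbe absv0.
have N2_le q : N2 q <= M * N1 q.
  have -> : N2 q = N2 (q %% p).
    rewrite /N2 [in LHS](divp_eq q p) rmorphD rmorphM hornerD hornerM pbe.
    by rewrite mulr0 add0r.
  have -> : N1 q = N1 (q %% p).
    rewrite /N1 [in LHS](divp_eq q p) rmorphD rmorphM hornerD hornerM (rootP pal).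
    by rewrite mulr0 add0r.
  by apply: N2_small; rewrite -ltnS prednK ?(ltnW p1) // ltn_modp.
(* If [N2 q] exceeded a positive [N1 q], the ratio for a high power of [q] would exceed [M]. *)
have N2_le1 q : N2 q <= N1 q.
  rewrite leNgt; apply/negP => N12; have N2q : 0 < N2 q by apply: le_lt_trans N12.
  have [N1q|N1q] := eqVneq (N1 q) 0.
    by have := N2_le q; rewrite N1q mulr0 leNgt N2q.
  have N1q0 : 0 < N1 q by rewrite lt_neqAle eq_sym N1q N10.
  have [|n' MN] := @expr_gt_bound R (N2 q / N1 q) M; first by rewrite ltr_pdivlMr ?mul1r.
  have N1X n0 : N1 (q ^+ n0) = N1 q ^+ n0.
    elim: n0 => [|n0 IH]; first by rewrite /N1 !expr0 rmorph1 hornerC absv1.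
    by rewrite !exprS N1M IH.
  have N2X n0 : N2 (q ^+ n0) = N2 q ^+ n0.
    elim: n0 => [|n0 IH]; first by rewrite /N2 !expr0 rmorph1 hornerC absv1.
    by rewrite !exprS N2M IH.
  have := N2_le (q ^+ n'); rewrite N1X N2X leNgt; move: MN.
  by rewrite expr_div_n ltr_pdivlMr ?exprn_gt0 // => ->.
(* For the reverse inequality with [N1 q != 0]: [q] is coprime to the minimal polynomial [p], so a
   Bezout relation gives [v] with [N1 v * N1 q = N2 v * N2 q], both being the absolute value of a
   nonzero constant, and [N2 v <= N1 v]. *)
move=> q; apply/eqP; rewrite eq_le N2_le1 andbT.
have [->//|N1q] := eqVneq (N1 q) 0.
have /Bezout_coprimepP[[u v] /= uv] : coprimep p q.
  set g := gcdp p q; have /dvdpP[h pE] : g %| p by exact: dvdp_gcdl.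
  have /dvdpP[h' qE] : g %| q by exact: dvdp_gcdr.
  have g0 : N1 g != 0.
    by apply: contraNneq N1q => g0; rewrite qE N1M g0 mulr0.
  have h0 : h != 0 by apply: contraNneq p0 => h0; rewrite pE h0 mul0r.
  have gn0 : g != 0 by apply: contraNneq p0 => g0'; rewrite pE g0' mulr0.
  have : (size p <= size h)%N.
    apply: free => //; apply/eqP; rewrite -absv_eq0 -[absv _]/(N1 h).
    by move: N1p; rewrite pE N1M => /eqP; rewrite mulf_eq0 (negbTE g0) orbF.
  rewrite {1}pE size_mul // /coprimep -/g; move: gn0 h0.
  rewrite -!size_poly_gt0; move: (size g) (size h) => m n'. lia.
have [d d0 uvE] : exists2 d : L, d != 0 & u * p + v * q = d%:P.
  move: uv; rewrite -size_poly_eq1 => /size_poly1P[d d0 ->].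
  by exists d.
have N1v : N1 v * N1 q = absv (i1 d).
  have := congr1 (fun r => absv (map_poly i1 r).[al]) uvE.
  by rewrite rmorphD rmorphM hornerD hornerM (rootP pal) mulr0 add0r map_polyC hornerC -N1M.
have N2v : N2 v * N2 q = absv (i1 d).
  have := congr1 (fun r => absv (map_poly i2 r).[be]) uvE.
  by rewrite rmorphD rmorphM hornerD hornerM pbe mulr0 add0r map_polyC hornerC -N2M i12.
have N1v0 : 0 < N1 v.
  rewrite lt_neqAle N10 andbT; apply: contraNneq d0 => v0.
  by move: N1v; rewrite -v0 mul0r => /esym/eqP; rewrite absv_eq0 fmorph_eq0.
by rewrite -(ler_pM2l N1v0) N1v -N2v ler_wpM2r.
Qed.

End UniqueExtension.

(** * Maximal isometries *)

Section IsometricRelations.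
Context {R : realType} {K : analyticFieldType R}.
Hypothesis K_closed : closed_subfield [set: K].
Implicit Types (A B : set (K * K)) (g h : K * K).

(** The graph of an isometry between two subrings of [K], as a subring of [K * K]. Applied to
    differences, [isom_absv] makes it single-valued and injective, and the definition is symmetric
    in the two coordinates. *)
Record isometric_ring A : Prop := IsometricRing {
  isom1 : A 1;
  isomB : forall g h, A g -> A h -> A (g - h);
  isomM : forall g h, A g -> A h -> A (g * h);
  isom_absv : forall g, A g -> absv g.1 = absv g.2 }.

Lemma isom0 A : isometric_ring A -> A 0.
Proof. by move=> iA; rewrite -(subrr 1); apply: isomB => //; exact: isom1. Qed.

Lemma isomD A g h : isometric_ring A -> A g -> A h -> A (g + h).
Proof.
move=> iA Ag Ah; rewrite -(opprK h) -[- h]sub0r.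
by apply: isomB => //; apply: isomB => //; exact: isom0.
Qed.

Lemma isomX A g n : isometric_ring A -> A g -> A (g ^+ n).
Proof.
move=> iA Ag; elim: n => [|n IH]; first exact: isom1.
by rewrite exprS; exact: isomM.
Qed.

Lemma isom_inj A a b b' : isometric_ring A -> A (a, b) -> A (a, b') -> b = b'.
Proof.
move=> iA Ab Ab'; have /= := isom_absv iA (isomB iA Ab Ab').
by rewrite subrr absv0 => /esym/eqP; rewrite absv_eq0 subr_eq0 => /eqP.
Qed.

Definition transpose A : set (K * K) := [set g | A (g.2, g.1)].

Lemma transpose_isometric A : isometric_ring A -> isometric_ring (transpose A).
Proof.
move=> iA; split; first exact: (isom1 iA).
- by move=> [a b] [c d] Ag Ah; exact: (isomB iA Ag Ah).
- by move=> [a b] [c d] Ag Ah; exact: (isomM iA Ag Ah).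
- by move=> [a b] Ag; rewrite (isom_absv iA Ag).
Qed.

Definition maximal_isometric A :=
  isometric_ring A /\ forall B, isometric_ring B -> A `<=` B -> B `<=` A.

Lemma transpose_maximal A :
  maximal_isometric A -> maximal_isometric (transpose A).
Proof.
move=> [iA maxA]; split; first exact: transpose_isometric.
move=> B iB AB [a b] Bab; apply: (maxA (transpose B) _ _ (b, a)) => //.
  exact: transpose_isometric.
by move=> [c d] Acd; exact: (AB (d, c)).
Qed.

Lemma exists_maximal_isometric A0 : isometric_ring A0 ->
  exists2 A, maximal_isometric A & A0 `<=` A.
Proof.
move=> iA0; pose P A := A = set0 \/ (isometric_ring A /\ A0 `<=` A).
have [|A [PA maxA]] := @Zorn_bigcup _ P.
  move=> C CP Ctot; have [[A [CA nA]]|noA] := pselect (exists A, C A /\ A <> set0); last first.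
    left; apply/seteqP; split=> // g [A CA Ag]; case: noA; exists A; split=> //.
    by move=> A0'; rewrite A0' in Ag.
  have CP' B : C B -> B !=set0 -> isometric_ring B /\ A0 `<=` B.
    by move=> CB [g Bg]; have [B0|//] := CP B CB; rewrite B0 in Bg.
  have both g h : (\bigcup_(X in C) X) g -> (\bigcup_(X in C) X) h ->
      exists B, [/\ C B, isometric_ring B, B g & B h].
    move=> [B CB Bg] [B' CB' B'h]; have [BB'|B'B] := Ctot B B' CB CB'.
      exists B'; split=> //; last exact: BB'.
      by apply: (CP' B' CB' _).1; exists h.
    exists B; split=> //; last exact: B'B.
    by apply: (CP' B CB _).1; exists g.
  have [iA AA] : isometric_ring A /\ A0 `<=` A by have [/nA|] := CP A CA.
  right; split; last by move=> g /AA Ag; exists A.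
  split.
  - by exists A => //; exact: isom1.
  - by move=> g h Ug Uh; have [B [CB iB Bg Bh]] := both g h Ug Uh; exists B => //; exact: isomB.
  - by move=> g h Ug Uh; have [B [CB iB Bg Bh]] := both g h Ug Uh; exists B => //; exact: isomM.
  - by move=> g Ug; have [B [CB iB Bg _]] := both g g Ug Ug; exact: (isom_absv iB Bg).
have [Anil|[iA A0A]] := PA.
  exfalso; apply: (maxA A0); last by right; split.
  by rewrite Anil; split=> // /(_ 1 (isom1 iA0)).
exists A => //; split=> // B iB AB; apply: contrapT => nBA.
apply: (maxA B); first by split.
by right; split=> //; exact: subset_trans AB.
Qed.

Definition pair_adherence A : set (K * K) := [set g | forall e : R, 0 < e ->
  exists2 h, A h & absv (g.1 - h.1) < e /\ absv (g.2 - h.2) < e].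

Lemma sub_pair_adherence A : A `<=` pair_adherence A.
Proof. by move=> g Ag e e0; exists g => //; rewrite !subrr !absv0. Qed.

Lemma pair_adherence_isometric A :
  isometric_ring A -> isometric_ring (pair_adherence A).
Proof.
move=> iA; split; first by apply: sub_pair_adherence; exact: isom1.
- move=> g h lg lh e e0; have [g' Ag' [g1 g2]] := lg e e0.
  have [h' Ah' [h1 h2]] := lh e e0.
  exists (g' - h'); first exact: isomB; split=> /=.
    have -> : g.1 - h.1 - (g'.1 - h'.1) = (g.1 - g'.1) - (h.1 - h'.1) by ring.
    by apply: le_lt_trans (absvB _ _) _; rewrite gt_max g1.
  have -> : g.2 - h.2 - (g'.2 - h'.2) = (g.2 - g'.2) - (h.2 - h'.2) by ring.
  by apply: le_lt_trans (absvB _ _) _; rewrite gt_max g2.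
- move=> g h lg lh e e0.
  have [d1 d10 d1P] := absv_mul_close g.1 h.1 e0.
  have [d2 d20 d2P] := absv_mul_close g.2 h.2 e0.
  have d0 : 0 < Num.min d1 d2 by rewrite lt_min d10.
  have [g' Ag'] := lg _ d0; rewrite !lt_min => -[/andP[g1 _] /andP[_ g2]].
  have [h' Ah'] := lh _ d0; rewrite !lt_min => -[/andP[h1 _] /andP[_ h2]].
  by exists (g' * h'); [exact: isomM|split; [exact: d1P|exact: d2P]].
have le g : (forall e, 0 < e -> exists2 h, absv h.1 = absv h.2 &
    absv (g.1 - h.1) < e /\ absv (g.2 - h.2) < e) -> absv g.2 <= absv g.1.
  move=> close; rewrite leNgt; apply/negP => lt12.
  have [h hE [h1 h2]] := close _ (le_lt_trans (absv_ge0 _) lt12).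
  have := absv_close h2; rewrite -hE => h1E.
  have : absv h.1 < absv g.2.
    rewrite -[h.1](subKr g.1); apply: le_lt_trans (absvB _ _) _.
    by rewrite gt_max lt12.
  by rewrite h1E ltxx.
move=> g lg; apply/eqP; rewrite eq_le; apply/andP; split.
  apply: (le (g.2, g.1)) => e /lg[h Ah [h1 h2]].
  by exists (h.2, h.1) => //=; rewrite (isom_absv iA Ah).
by apply: le => e /lg[h Ah hP]; exists h => //; exact: isom_absv Ah.
Qed.

Section Maximal.
Variable A : set (K * K).
Hypothesis maxA : maximal_isometric A.
Let iA : isometric_ring A := maxA.1.

Lemma maximal_adherence : pair_adherence A `<=` A.
Proof. exact: (maxA.2 _ (pair_adherence_isometric iA) (@sub_pair_adherence A)). Qed.

(** Isometries preserve Cauchy sequences, and [A] is closed because its closure is again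
    isometric. *)
Lemma maximal_limit (u v : nat -> K) x :
  (forall n, A (u n, v n)) -> abs_lim u x ->
  exists2 y, abs_lim v y & A (x, y).
Proof.
move=> Auv ux; have cv : abs_cauchy v.
  move=> e e0; have [N uN] := abs_lim_cauchy ux e0; exists N => m n Nm Nn.
  have /= <- := isom_absv iA (isomB iA (Auv m) (Auv n)).
  exact: uN.
have [y vy] := abs_cauchy_cvg cv; exists y => //; apply: maximal_adherence => e e0.
have [N uN] := ux e e0; have [M vM] := vy e e0.
exists (u (maxn N M), v (maxn N M)) => //=.
by split; [apply: uN; exact: leq_maxl|apply: vM; exact: leq_maxr].
Qed.

Lemma maximal_inv a b : A (a, b) -> A (a^-1, b^-1).
Proof.
move=> Aab; have /= abE := isom_absv iA Aab.
have [a0|a0] := eqVneq a 0.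
  have b0 : b = 0 by apply/eqP; rewrite -absv_eq0 -abE a0 absv0.
  by rewrite a0 b0 !invr0; exact: isom0.
have b0 : b != 0 by rewrite -absv_eq0 -abE absv_eq0.
pose g' : K * K := (a^-1, b^-1).
have gg' : (a, b) * g' = 1 by congr pair; rewrite divff.
have gg'n n : (a, b) ^+ n * g' ^+ n = 1 by rewrite -exprMn gg' expr1n.
(* The localization of [A] at the powers of [(a, b)] is still isometric, so maximality applies to
   it. *)
pose B : set (K * K) := [set g | exists h n, A h /\ g = h * g' ^+ n].
apply: (maxA.2 B); last by exists 1, 1%N; split; [exact: isom1|rewrite mul1r expr1].
  split.
  - by exists 1, 0%N; split; [exact: isom1|rewrite mulr1].
  - move=> _ _ [h [n [Ah ->]]] [h' [n' [Ah' ->]]].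
    exists (h * (a, b) ^+ n' - h' * (a, b) ^+ n), (n + n')%N; split.
      by apply: isomB => //; apply: isomM => //; exact: isomX.
    rewrite mulrBl exprD mulrACA gg'n mulr1; congr (_ - _).
    by rewrite [g' ^+ n * _]mulrC mulrACA gg'n mulr1.
  - move=> _ _ [h [n [Ah ->]]] [h' [n' [Ah' ->]]].
    by exists (h * h'), (n + n')%N; split; [exact: isomM|rewrite exprD mulrACA].
  - move=> _ [h [n [Ah ->]]] /=.
    have fstX : (g' ^+ n).1 = a^-1 ^+ n by exact: (rmorphXn fst).
    have sndX : (g' ^+ n).2 = b^-1 ^+ n by exact: (rmorphXn snd).
    by rewrite fstX sndX !absvM !absvX !absvV abE (isom_absv iA Ah).
by move=> h Ah; exists h, 0%N; rewrite mulr1.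
Qed.

Lemma maximal_fst_subfield : is_subfield (fst @` A).
Proof.
apply: is_subfieldI; first by exists 1 => //; exact: isom1.
- move=> _ _ [g Ag <-] [h Ah <-]; exists (g - h) => //; exact: isomB.
- move=> _ _ [g Ag <-] [[a b] Ah <-]; exists (g * (a^-1, b^-1)) => //.
  by apply: isomM => //; exact: maximal_inv.
Qed.

Lemma maximal_fst_closed : lim_closed (fst @` A).
Proof.
move=> x /adherence_seq[u [uA ux]].
have /choice[v vP] n : exists v, A (u n, v).
  by have [[a b] Ag <-] := uA n; exists b.
by have [y _ Axy] := maximal_limit vP ux; exists (x, y).
Qed.

Let L := subfield_of maximal_fst_subfield.

Lemma partner_ex (a : L) : exists b, A (val a, b).
Proof. by have [[x b] Ag /= <-] := subfield_valP a; exists b. Qed.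

Definition partner (a : L) : K := sval (cid (partner_ex a)).

Lemma partnerP a : A (val a, partner a).
Proof. exact: svalP (cid (partner_ex a)). Qed.

Lemma partner_zmod : zmod_morphism partner.
Proof.
move=> a b; apply: (isom_inj iA (partnerP (a - b))).
by rewrite rmorphB; exact: (isomB iA (partnerP a) (partnerP b)).
Qed.

Lemma partner_monoid : monoid_morphism partner.
Proof.
split.
  by apply: (isom_inj iA (partnerP 1)); rewrite rmorph1; exact: isom1.
move=> a b; apply: (isom_inj iA (partnerP (a * b))).
by rewrite rmorphM; exact: (isomM iA (partnerP a) (partnerP b)).
Qed.

HB.instance Definition _ := GRing.isZmodMorphism.Build L K partner partner_zmod.
HB.instance Definition _ := GRing.isMonoidMorphism.Build L K partner partner_monoid.

(** For [al] algebraic over the domain, [unique_extension] gives [be] such that [al] can be sent to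
    [be] isometrically; the pairs of values at [al] and [be] form an isometric ring containing [A],
    so [al] is already in the domain. *)
Lemma maximal_fst_alg_closed : closed_subfield (fst @` A).
Proof.
pose sL := maximal_fst_subfield.
split=> // p /(polyOver_coefs_in _ (subfield0 sL)) Lp p1.
have [|al _ pal] := K_closed.2 p _ p1; first exact/polyOver_coefs_in.
exists al => //.
pose i1 : {rmorphism L -> K} := val.
pose i2 : {rmorphism L -> K} := partner.
have i12 a : absv (i1 a) = absv (i2 a) by exact: (isom_absv iA (partnerP a)).
have i1cl : lim_closed (range i1).
  have -> : range i1 = fst @` A.
    apply/seteqP; split=> [_ [a _ <-]|x /(subfield_of_ex sL)[a <-]].
      exact: subfield_valP.
    by exists a.
  exact: maximal_fst_closed.
have algal : algebraicOver i1 al.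
  have [q pE] := coefs_in_lift sL Lp; exists q; last by rewrite /i1 -pE.
  by apply: contraTneq p1 => q0; rewrite pE q0 rmorph0 size_poly0.
have [be beP] := unique_extension i12 i1cl K_closed algal.
pose B : set (K * K) :=
  range (fun q : {poly L} => ((map_poly i1 q).[al], (map_poly i2 q).[be])).
have iB : isometric_ring B.
  split.
  - by exists 1 => //; rewrite !rmorph1 !hornerC.
  - by move=> _ _ [q _ <-] [r _ <-]; exists (q - r); rewrite // !rmorphB !hornerD !hornerN.
  - by move=> _ _ [q _ <-] [r _ <-]; exists (q * r); rewrite // !rmorphM !hornerM.
  - by move=> _ [q _ <-]; exact: beP.
exists (al, be) => //; apply: (maxA.2 B iB); last first.
  by exists 'X => //; rewrite !map_polyX !hornerX.
move=> [x y] Axy; have [|a aE] := @subfield_of_ex _ _ sL x; first by exists (x, y).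
exists a%:P => //; rewrite !map_polyC !hornerC /i1 /i2 /= aE; congr pair.
by apply: (isom_inj iA _ Axy); rewrite -aE; exact: partnerP.
Qed.

End Maximal.
End IsometricRelations.

(** * Distances to intermediate fields *)

Section LargeChain.
Context {R : realType} {k K : analyticFieldType R} (iota : {rmorphism k -> K}).
Hypothesis K_closed : closed_subfield [set: K].
Implicit Types (x y : K) (F G E : set K).

Local Notation ta x := (ta_closure iota [set x]).
Local Notation interm := (intermediate iota).

Hypothesis ta_total : forall x y, ta x y \/ ta y x.
Hypothesis ta_proper : forall x, exists w, ~ ta x w.

Lemma poly_eval_isometric F x y : closed_subfield F -> lim_closed F -> ~ F x ->
  absv (y - x) < dist x F ->
  isometric_ring [set g : K * K | exists2 q, coefs_in F q & g = (q.[x], q.[y])].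
Proof.
move=> cF lF nFx yx; have sF := cF.1.
have d0 := dist_gt0 (ex_intro _ _ (subfield1 sF)) lF nFx.
split.
- exists 1; last by rewrite !hornerC.
  by apply: (coefs_inC sF); exact: subfield1.
- move=> _ _ [q Fq ->] [r Fr ->]; exists (q - r); first exact: coefs_inB.
  by rewrite !hornerD !hornerN.
- move=> _ _ [q Fq ->] [r Fr ->]; exists (q * r); first exact: coefs_inM.
  by rewrite !hornerM.
move=> _ [q Fq ->] /=.
have th01 : 0 <= absv (y - x) / dist x F < 1.
  by rewrite divr_ge0 ?absv_ge0 ?(ltW d0) //= ltr_pdivrMr // mul1r.
have hy a : F a -> absv (y - x) <= absv (y - x) / dist x F * absv (x - a).
  move=> Fa; rewrite mulrAC ler_pdivlMr //.
  by rewrite ler_wpM2l ?absv_ge0 // dist_le.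
by have [_ ->] := perturb_horner cF th01 hy Fq.
Qed.

Lemma preimage_intermediate E A : interm E -> maximal_isometric A ->
    E `<=` snd @` A -> (forall c, range iota c -> A (c, c)) ->
  interm [set a | exists2 b, E b & A (a, b)].
Proof.
move=> [[sE aE] kE lE] maxA EA kA; have iA := maxA.1; split.
- have sG : is_subfield [set a | exists2 b, E b & A (a, b)].
    apply: is_subfieldI.
    + by exists 1; [exact: subfield1|exact: isom1].
    + move=> a a' [b Eb Aab] [b' Eb' Aab']; exists (b - b').
        exact: subfieldB.
      exact: (isomB iA Aab Aab').
    + move=> a a' [b Eb Aab] [b' Eb' Aab']; exists (b / b').
        exact: subfield_div.
      exact: (isomM iA Aab (maximal_inv maxA Aab')).
  split=> // p /(polyOver_coefs_in _ (subfield0 sG)) Gp p1.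
  have /choice[b bP] i : exists b, E b /\ A (p`_i, b).
    by have [b Eb Ab] := Gp i; exists b.
  pose q := \poly_(i < size p) b i.
  have qp : size q = size p.
    apply: size_poly_eq; rewrite -absv_eq0.
    have /= <- := isom_absv iA (bP (size p).-1).2.
    by rewrite absv_eq0 -lead_coefE lead_coef_eq0 -size_poly_gt0 ltnW.
  have [||y Ey qy] := aE q.
  + apply/(polyOver_coefs_in _ (subfield0 sE)) => i; rewrite coef_poly.
    by case: ifP => _; [case: (bP i)|exact: subfield0].
  + by rewrite qp.
  have [[a b'] Aay /= yE] := EA y Ey; rewrite {}yE in Aay.
  exists a; first by exists y.
  (* [q] is the image of [p] under the isometry and [y] that of [a], so [p.[a]] has the absolute
     value of [q.[y] = 0]. *)
  have /(isom_absv iA)/= : A (p.[a], q.[y]).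
    rewrite horner_coef horner_poly.
    elim: (size p) => [|n IH]; first by rewrite !big_ord0; exact: isom0.
    have ayn : A (a ^+ n, y ^+ n).
      have := isomX n iA Aay; rewrite [X in A X](_ : _ = (a ^+ n, y ^+ n)) //.
      by rewrite [LHS]surjective_pairing (rmorphXn fst) (rmorphXn snd).
    by rewrite !big_ord_recr; exact: (isomD iA IH (isomM iA (bP n).2 ayn)).
  by rewrite (rootP qy) absv0 => /eqP; rewrite absv_eq0.
- by move=> c kc; exists c; [exact: kE|exact: kA].
- move=> x /adherence_seq[u [uG ux]].
  have /choice[v vP] n : exists v, E v /\ A (u n, v).
    by have [b Eb Ab] := uG n; exists b.
  have [y vy Axy] := maximal_limit maxA (fun n => (vP n).2) ux.
  by exists y => //; apply: lE; apply: lim_point vy => n; case: (vP n).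
Qed.

(* [A] is the graph of an isometry fixing [F] and mapping [x] to [x + u], where
   [rho < dist u (ta x)] and [absv u < dist x F]; its image contains [ta x], and
   the required field is the preimage of [ta x]. *)
Lemma intermediate_dist_gt F x (rho : R) : interm F -> ~ F x ->
    0 < rho -> rho < dist x F ->
  exists G, [/\ interm G, F `<=` G, exists2 y, G y & ~ F y & rho < dist x G].
Proof.
move=> iF nFx rho0 rhos; have [cF kF lF] := iF; have sF := cF.1.
have [w0 nEw0] := ta_proper x.
have iE := ta_interm iota K_closed x; have [cE kE lE] := iE; have sE := cE.1.
have E0 := interm_nonempty iE.
have [e Ee e1] := ta_value_gt1 K_closed ta_total iF nFx nEw0.
have FE := interm_sub_ta K_closed ta_total iF nFx.
have D0 := dist_gt0 E0 lE nEw0; set D := dist w0 _ in D0.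
have s0 : 0 < dist x F by apply: lt_trans rhos.
(* Translation by [e0] keeps the lower bound [D] for distances to [ta x] and makes [absv w / D] less
   than [dist x F / rho]. This leaves room for a scalar [c] in [ta x] with [rho < absv c * D] and
   [absv c * absv w < dist x F]. *)
have [||e0 Ee0 we0] := @dist_lt _ _ w0 (ta x) (D * (dist x F / rho)) => //.
  by rewrite ltr_pMr // ltr_pdivlMr // mul1r.
pose w := w0 - e0.
have wD a : ta x a -> D <= absv (w - a).
  move=> Ea; rewrite /w -addrA -opprD; exact: (dist_le w0 (subfieldD sE Ee0 Ea)).
have w_gt0 : 0 < absv w.
  by apply: lt_le_trans D0 _; rewrite -[w]subr0; apply: wD; exact: (subfield0 sE).
have [||c Ec /andP[c1 c2]] := @value_dense _ _ (ta x) e (rho / D) (dist x F / absv w) cE Ee e1.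
- by rewrite divr_gt0.
- rewrite ltr_pdivrMr // mulrAC ltr_pdivlMr //.
  by move: we0; rewrite -/w mulrA ltr_pdivlMr // [rho * _]mulrC [dist x F * _]mulrC.
have c0 : c != 0 by rewrite -absv_gt0; apply: lt_trans c1; rewrite divr_gt0.
pose u := c * w.
have us : absv u < dist x F by rewrite absvM -ltr_pdivlMr.
have uD b : ta x b -> absv c * D <= absv (u - b).
  move=> Eb; have -> : u - b = c * (w - b / c) by rewrite /u; field.
  by rewrite absvM ler_wpM2l ?absv_ge0 //; apply: wD; exact: (subfield_div sE Eb Ec).
have cD : rho < absv c * D by rewrite -ltr_pdivrMr.
pose x0 := x + u.
have nEx0 : ~ ta x x0.
  move=> Ex0; have /uD : ta x u.
    suff <- : x0 - x = u by exact: (subfieldB sE Ex0 (ta_self iota x)).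
    by rewrite /x0 addrC addKr.
  by rewrite subrr absv0 leNgt (lt_trans rho0).
have x0x : absv (x0 - x) < dist x F by rewrite /x0 addrAC subrr add0r.
have [A maxA A0A] := exists_maximal_isometric (poly_eval_isometric cF lF nFx x0x).
have iA := maxA.1.
have FA c' : F c' -> A (c', c').
  by move=> Fc; apply: A0A; exists c'%:P; [exact: coefs_inC|rewrite !hornerC].
have Axx0 : A (x, x0).
  by apply: A0A; exists 'X; [exact: coefs_inX|rewrite !hornerX].
have iA2 : interm (snd @` A).
  have A2E : snd @` A = fst @` (transpose A).
    apply/seteqP; split=> _ [[a b] Aab <-]; first by exists (b, a).
    by exists (b, a).
  split.
  - rewrite A2E; apply: maximal_fst_alg_closed => //; exact: transpose_maximal.
  - by move=> c' /kF/FA Ac; exists (c', c').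
  - rewrite A2E; apply: maximal_fst_closed; exact: transpose_maximal.
(* The image is an intermediate field containing [x0], which is outside [ta x]; in a chain it must
   contain [ta x]. *)
have EA2 : ta x `<=` snd @` A.
  have A2x0 : (snd @` A) x0 by exists (x, x0).
  move=> y /(interm_sub_ta K_closed ta_total iE nEx0).
  exact: ta_sub A2x0 y.
exists [set a | exists2 b, ta x b & A (a, b)]; split.
- by apply: preimage_intermediate => // c' /kF/FA.
- by move=> c' Fc'; exists c'; [exact: FE|exact: FA].
- have [[a b] Aax /= bE] := EA2 x (ta_self iota x); rewrite {}bE in Aax.
  exists a; first by exists x => //; exact: ta_self.
  move=> Fa; apply: nFx; suff -> : x = a by [].
  by apply: (isom_inj iA Aax); exact: FA.
apply: lt_le_trans cD _; apply: dist_ge.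
  by exists 0, 0; [exact: (subfield0 sE)|exact: isom0].
move=> a [b Eb Aab]; have /= -> := isom_absv iA (isomB iA Axx0 Aab).
have -> : x0 - b = u - (b - x) by rewrite /x0; ring.
by apply: uD; exact: (subfieldB sE Eb (ta_self iota x)).
Qed.

Lemma chain_union_intermediate (C : set (set K)) : C !=set0 ->
  (forall F, C F -> interm F) -> interm (adherence (\bigcup_(F in C) F)).
Proof.
move=> [F0 CF0] iC; set U := \bigcup_(F in C) F.
have both x y : U x -> U y -> exists F, [/\ C F, F x & F y].
  move=> [F CF Fx] [G CG Gy].
  have [FG|GF] := interm_total ta_total (iC F CF) (iC G CG).
    by exists G; split=> //; exact: FG.
  by exists F; split=> //; exact: GF.
have sub F : C F -> is_subfield F by move=> /iC[[]].
have cU : closed_subfield U.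
  have sU : is_subfield U.
    apply: is_subfieldI.
    - by exists F0 => //; exact: (subfield1 (sub _ CF0)).
    - move=> x y Ux Uy; have [F [CF Fx Fy]] := both x y Ux Uy.
      by exists F => //; apply: subfieldB => //; exact: sub.
    - move=> x y Ux Uy; have [F [CF Fx Fy]] := both x y Ux Uy.
      by exists F => //; apply: subfield_div => //; exact: sub.
  split=> // p /(polyOver_coefs_in _ (subfield0 sU)) Up p1.
  have [F CF Fp] : exists2 F, C F & forall i, (i < size p)%N -> F p`_i.
    elim: (size p) => [|n [F CF Fp]]; first by exists F0.
    have [G CG Gn] := Up n.
    have [FG|GF] := interm_total ta_total (iC F CF) (iC G CG).
      exists G => // i; rewrite ltnS leq_eqVlt => /orP[/eqP->//|/Fp]; exact: FG.
    by exists F => // i; rewrite ltnS leq_eqVlt => /orP[/eqP->|/Fp//]; exact: GF.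
  have [[sF aF] _ _] := iC F CF.
  have [|x Fx px] := aF p _ p1; last by exists x => //; exists F.
  apply/(polyOver_coefs_in _ (subfield0 sF)) => i.
  by have [/Fp//|pi] := ltnP i (size p); rewrite nth_default //; exact: subfield0.
split.
- exact: adherence_alg_closed.
- move=> c kc; apply: sub_adherence; exists F0 => //.
  by have [_ kF _] := iC F0 CF0; exact: kF.
- exact: adherence_closed.
Qed.

(** The closed union [G] of all fields above [F] at distance at least [rho] from [x] is still at
    distance at least [rho]. If the distance were larger, [intermediate_dist_gt] would give a
    strictly larger field of the same family. *)
Lemma intermediate_dist_eq F x (rho : R) : interm F -> ~ F x ->
    0 < rho -> rho <= dist x F ->
  exists G, [/\ interm G, F `<=` G & dist x G = rho].
Proof.
move=> iF nFx rho0 rhoF.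
pose C : set (set K) := [set G | [/\ interm G, F `<=` G & rho <= dist x G]].
have CF : C F by split.
have iC G : C G -> interm G by case.
have iG := chain_union_intermediate (ex_intro _ F CF) iC.
set G := adherence _ in iG.
have CG H : C H -> H `<=` G.
  by move=> CH y Hy; apply: sub_adherence; exists H.
have rhoG : rho <= dist x G.
  apply: dist_ge; first exact: interm_nonempty iG.
  move=> a Ga; rewrite leNgt; apply/negP => xa.
  have [b [H [_ _ rhoH] Hb] ab] := Ga _ rho0.
  by have := absv_dist_trans xa ab; rewrite ltNge (le_trans rhoH) // dist_le.
exists G; split=> //; first exact: CG.
apply/eqP; rewrite eq_le rhoG andbT leNgt; apply/negP => ltG.
have nGx : ~ G x.
  by move=> /(dist_le x); rewrite subrr absv0 leNgt (lt_trans rho0).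
have [H [iH GH [y Hy nGy] ltH]] := intermediate_dist_gt iG nGx rho0 ltG.
apply: nGy; apply: (CG H) Hy; split=> //; last exact: ltW.
exact: subset_trans (CG F CF) GH.
Qed.

(** A subfield containing a ball contains a ball around 0, and any [w] is the quotient of
    [w / e ^+ n] by [1 / e ^+ n], both in that ball for large [n]. *)
Lemma proper_interior F (e : K) a (r : R) : interm F -> 1 < absv e ->
  (exists w, ~ F w) -> 0 < r -> exists2 b, absv (a - b) < r & ~ F b.
Proof.
move=> [[sF _] _ _] e1 [w nFw] r0; apply: contrapT => all_in.
have ball_in z : absv z < r -> F z.
  move=> zr; have aF b : absv (a - b) < r -> F b.
    by move=> ab; apply: contrapT => nFb; apply: all_in; exists b.
  rewrite -(addrK a z); apply: subfieldB => //; apply: aF.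
    by rewrite opprD addrCA subrr addr0 absvN.
  by rewrite subrr absv0.
have [n nP] := expr_gt_bound (Num.max (1 / r) (absv w / r)) e1.
have en0 : 0 < absv (e ^+ n).
  by rewrite absvX exprn_gt0 // (lt_trans ltr01).
move: nP; rewrite -absvX gt_max !ltr_pdivrMr // => /andP[n1 n2].
have e0 : e ^+ n != 0 by rewrite -absv_gt0.
apply: nFw; have -> : w = (w / e ^+ n) / (1 / e ^+ n) by field; rewrite e0 oner_neq0.
apply: subfield_div => //; apply: ball_in; rewrite absvM absvV ltr_pdivrMr //.
  by rewrite mulrC.
by rewrite absv1 mulrC.
Qed.

(* Baire category: each [F n] is closed with empty interior. *)
Lemma countable_union_proper (F : nat -> set K) :
  (forall n, interm (F n)) -> (forall n, exists w, ~ F n w) ->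
  exists y, forall n, ~ F n y.
Proof.
move=> iF pF; have [w nFw] := pF 0%N; have [w' nw'] := ta_proper w.
have [e _ e1] := ta_value_gt1 K_closed ta_total (iF 0%N) nFw nw'.
(* Pairs are balls (centre, radius). A new radius at most [1 / (n + 1)] makes the centres Cauchy,
   and one at most [dist a (F n)] keeps the ball off [F n]. *)
have step n (b : K * R) : exists b' : K * R, 0 < b.2 ->
    [/\ absv (b.1 - b'.1) < b.2, 0 < b'.2, b'.2 <= b.2, b'.2 <= n.+1%:R^-1 &
        forall y, absv (b'.1 - y) < b'.2 -> ~ F n y].
  have [b0|b0] := leP b.2 0; first by exists b.
  have [a ba nFa] := proper_interior b.1 (iF n) e1 (pF n) b0.
  have [_ _ lF] := iF n; have d0 := dist_gt0 (interm_nonempty (iF n)) lF nFa.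
  exists (a, Num.min b.2 (Num.min n.+1%:R^-1 (dist a (F n)))) => _ /=.
  split=> //; rewrite ?lt_min ?b0 ?d0 ?invr_gt0 ?ltr0n ?ge_min ?lexx ?orbT //.
  move=> y; rewrite !lt_min => /and3P[_ _ ay] Fy.
  by move: ay; rewrite ltNge dist_le.
have /choice[nxt nxtP] : forall nb : nat * (K * R), exists b' : K * R, 0 < nb.2.2 ->
    [/\ absv (nb.2.1 - b'.1) < nb.2.2, 0 < b'.2, b'.2 <= nb.2.2, b'.2 <= nb.1.+1%:R^-1 &
        forall y, absv (b'.1 - y) < b'.2 -> ~ F nb.1 y].
  by move=> [n b]; exact: step.
pose b := fix b n := if n is m.+1 then nxt (m, b m) else (0, 1).
have b_gt0 n : 0 < (b n).2.
  by elim: n => [|n IH] /=; [exact: ltr01|case: (nxtP (n, b n) IH)].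
have bP n := nxtP (n, b n) (b_gt0 n).
have bdec n m : (b (n + m)%N).2 <= (b n).2.
  elim: m => [|m IH]; first by rewrite addn0.
  by rewrite addnS; apply: le_trans IH; case: (bP (n + m)%N).
have bnear n m : absv ((b n).1 - (b (n + m)%N).1) < (b n).2.
  elim: m => [|m IH]; first by rewrite addn0 subrr absv0.
  apply: absv_dist_trans IH _; apply: lt_le_trans (bdec n m).
  by rewrite addnS; case: (bP (n + m)%N).
have cb : abs_cauchy (fun n => (b n).1).
  move=> d d0; set N := (Num.truncn d^-1).+1; exists N.+1 => m n Nm Nn.
  have bN : (b N.+1).2 < d.
    have [_ _ _ bN _] := bP N; apply: le_lt_trans bN _.
    rewrite invf_plt ?posrE //; apply: lt_le_trans (truncnS_gt _) _.
    by rewrite ler_nat /N.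
  apply: lt_trans bN; apply: (absv_dist_trans (y := (b N.+1).1)).
    by rewrite absvBC -(subnKC Nm).
  by rewrite -(subnKC Nn).
have [y yb] := abs_cauchy_cvg cb; exists y => n.
have [_ _ _ _] := bP n; apply; have [N NP] := yb _ (b_gt0 n.+1).
rewrite -/(b n.+1); apply: (absv_dist_trans (bnear n.+1 N)).
by rewrite absvBC; apply: NP; exact: leq_addl.
Qed.

End LargeChain.

(** * Orders isomorphic to the long ray *)

Lemma porder_topology_open_ray d (T : porderType d) (i : interval T) :
  itv_is_open_unbounded i -> open ([set` i] : set (porder_topology T)).
Proof.
move=> oi; exists [set [set` i]]; last by rewrite bigcup_set1.
by move=> _ ->; exists [fset (i : @ray_index _ T)]%fset;
  [move=> j /[!inE] /eqP->|rewrite set_fset1 bigcap_set1].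
Qed.

Lemma porder_topology_mono_continuous d1 d2 (T1 : porderType d1) (T2 : porderType d2)
    (f : T1 -> T2) (g : T2 -> T1) : cancel f g -> cancel g f ->
    {mono f : x y / (x < y)%O} ->
  continuous (f : porder_topology T1 -> porder_topology T2).
Proof.
move=> fK gK fmono; apply/continuousP => _ [C CI <-].
rewrite preimage_bigcup; apply: bigcup_open => B CB.
have [D DI <-] := CI B CB; rewrite preimage_bigcap bigcap_fset big_seq.
elim/big_ind: _ => [||i iD]; [exact: openT|exact: openI|].
have := DI i iD; rewrite inE; case: i {iD} => -[[] a|[]] [[] b|[]] //= _.
- rewrite (_ : _ @^-1` _ = [set` `](g a), +oo[]); first exact: porder_topology_open_ray.
  by apply/seteqP; split=> x; rewrite /= !in_itv /= !andbT -(fmono (g a)) gK.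
- rewrite (_ : _ @^-1` _ = [set` `]-oo, (g b)[]); first exact: porder_topology_open_ray.
  by apply/seteqP; split=> x; rewrite /= !in_itv /= -(fmono _ (g b)) gK.
- rewrite (_ : _ @^-1` _ = setT); first exact: openT.
  by apply/seteqP; split=> x.
Qed.

Lemma order_bijection_homeomorphic d1 d2 (T1 : porderType d1) (T2 : orderType d2)
    (g : T2 -> T1) : {homo g : x y / (x < y)%O} -> (forall y, exists x, g x = y) ->
  homeomorphic (porder_topology T1) (order_topology T2).
Proof.
move=> ghomo /choice[f gf].
have gmono : {mono g : x y / (x < y)%O}.
  move=> x y; case: (ltgtP x y) => [/ghomo->//|/ghomo yx|->]; last by rewrite ltxx.
  by rewrite lt_gtF.
have gK : cancel g f.
  move=> x; case: (ltgtP (f (g x)) x) => // /ghomo; by rewrite gf ltxx.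
have fmono : {mono f : x y / (x < y)%O} by move=> x y; rewrite -gmono !gf.
have fc := porder_topology_mono_continuous gf gK fmono.
have gc := porder_topology_mono_continuous gK gf gmono.
by exists f, g.
Qed.

Lemma with_top_ltE d (T : orderType d) (x y : T) :
  ((Some x : with_top T) < (Some y : with_top T))%O = (x < y)%O.
Proof. by rewrite !lt_neqAle. Qed.

(** * Gluing charts along [omega1] *)

Section LongRay.
Context (R : realType) {d : Order.disp_t} {T : porderType d} (top : T).
Hypothesis T_total : forall x y : T, (x <= y)%O \/ (y <= x)%O.
Hypothesis le_top : forall x, (x <= top)%O.
Hypothesis countable_lub : forall A : set T, countable A -> ~ A top ->
  exists2 s, s != top & (forall x, A x -> (x <= s)%O) /\
    forall u, (forall x, A x -> (x <= u)%O) -> (s <= u)%O.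
Hypothesis chart : forall x : T, x != top -> exists (x' : T) (h : ico01 R -> T),
  [/\ x' != top, (x < x')%O, {homo h : s t / (s < t)%O},
      forall t, (x <= h t < x')%O &
      forall y, (x <= y)%O -> (y < x')%O -> exists t, h t = y].
Hypothesis decreasing_height : forall x : T, x != top -> exists phi : T -> R,
  forall y z, (y < z)%O -> (z <= x)%O -> phi z < phi y.

Lemma not_ltT (x y : T) : ~ (x < y)%O -> (y <= x)%O.
Proof.
have [xy|//] := T_total x y; rewrite le_eqVlt in xy.
by case/predU1P: xy => [->|//].
Qed.

Lemma exists_chart : exists (next : T -> T) (h : T -> ico01 R -> T),
  forall x, x != top ->
  [/\ next x != top, (x < next x)%O, {homo h x : s t / (s < t)%O},
      forall t, (x <= h x t < next x)%O &
      forall y, (x <= y)%O -> (y < next x)%O -> exists t, h x t = y].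
Proof.
have /choice[c cP] x : exists c : T * (ico01 R -> T), x != top ->
  [/\ c.1 != top, (x < c.1)%O, {homo c.2 : s t / (s < t)%O},
      forall t, (x <= c.2 t < c.1)%O &
      forall y, (x <= y)%O -> (y < c.1)%O -> exists t, c.2 t = y].
  have [->|/chart[x' [h hP]]] := eqVneq x top; first by exists (top, fun=> top).
  by exists (x', h).
by exists (fun x => (c x).1), (fun x => (c x).2).
Qed.

Lemma omega1_lt_wf : well_founded (fun x y : omega1 => (x < y)%O).
Proof.
move=> x; apply: contrapT => nx.
have [y ny ymin] := @omega1_wf [set y | ~ Acc (fun x y : omega1 => (x < y)%O) y]
  (ex_intro _ x nx).
apply: ny; constructor => z zy; apply: contrapT => nz.
by have := ymin z nz; rewrite leNgt zy.
Qed.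

Lemma omega1_no_max (al : omega1) : exists be : omega1, (al < be)%O.
Proof.
apply: contrapT => nbe; apply: omega1_uncountable.
have -> : [set: omega1] = \bigcup_(b in [set: bool])
    (if b then [set y | (y < al)%O] else [set al]).
  apply/seteqP; split=> // y _; have [ya|ay|->] := ltgtP y al.
  - by exists true.
  - by case: nbe; exists y.
  - by exists false.
apply: bigcup_countable; first exact: countableP.
by move=> [] _; [exact: omega1_initial_segment|exact: countable1].
Qed.

(** Well-founded recursion: [f al] is the least upper bound of all [next (f be)] with [be < al]. It
    exists below [top] because initial segments of [omega1] are countable; for the first index it is
    the least element of [T]. *)
Lemma transfinite_sequence (next : T -> T) :
    (forall x, x != top -> next x != top) ->
  exists f : omega1 -> T, forall al,
    [/\ f al != top, forall be, (be < al)%O -> (next (f be) <= f al)%O &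
        forall u, (forall be, (be < al)%O -> (next (f be) <= u)%O) -> (f al <= u)%O].
Proof.
move=> nextP.
have /choice[lub lubP] (A : set T) : exists s, countable A -> ~ A top ->
    s != top /\ (forall x, A x -> (x <= s)%O) /\
    forall u, (forall x, A x -> (x <= u)%O) -> (s <= u)%O.
  (* [top] is a default value for sets without a guaranteed bound. *)
  have [[cA nA]|nA] := pselect (countable A /\ ~ A top); last first.
    by exists top => cA nAt; case: nA.
  by have [s s1 s2] := countable_lub cA nA; exists s.
pose step (al : omega1) (rec : forall be, (be < al)%O -> T) :=
  lub [set z | exists be (lt : (be < al)%O), z = next (rec be lt)].
pose f := Fix omega1_lt_wf (fun=> T) step.
have fE al : f al = lub [set next (f be) | be in [set be | (be < al)%O]].
  rewrite /f Fix_eq; last first.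
    move=> x g g' gg'; rewrite /step; congr lub.
    by apply/seteqP; split=> _ [be [lt ->]]; exists be, lt; rewrite gg'.
  rewrite -/f /step; congr lub; apply/seteqP; split.
    by move=> _ [be [lt ->]]; exists be.
  by move=> _ [be lt <-]; exists be, lt.
exists f; apply: (well_founded_ind omega1_lt_wf) => al IH.
set A := [set next (f be) | be in [set be | (be < al)%O]].
have [||ftop [fub flub]] := lubP A.
- exact: sub_countable (card_image_le _ _) (omega1_initial_segment al).
- by move=> [be /IH[ftop _ _] nE]; have := nextP _ ftop; rewrite nE eqxx.
rewrite -fE in ftop fub flub; split=> //.
  by move=> be lt; apply: fub; exists be.
by move=> u uP; apply: flub => _ [be lt <-]; exact: uP.
Qed.

Lemma long_ray_homeomorphic :
  homeomorphic (porder_topology T) (order_topology (with_top (long_ray R))).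
Proof.
have [next [h hP]] := exists_chart.
have [|f fP] := @transfinite_sequence next; first by move=> x /hP[].
(* If [f] were bounded by [G], rationals chosen between the heights of [next (f al)] and [f al]
   would strictly decrease with [al], so [omega1] would embed into the rationals. *)
have f_cofinal G : G != top -> exists al, (G < f al)%O.
  move=> /decreasing_height[phi phiP]; apply: contrapT => noal.
  have fG al : (f al <= G)%O by apply: not_ltT => Gf; apply: noal; exists al.
  have nextG al : (next (f al) <= G)%O.
    have [be albe] := omega1_no_max al; apply: le_trans (fG be).
    by have [_ nextf _] := fP be; exact: nextf.
  have /choice[q qP] al : exists q : rat, phi (next (f al)) < ratr q < phi (f al).
    have lt : phi (next (f al)) < phi (f al).
      by apply: phiP (nextG al); have [ftop _ _] := fP al; case: (hP _ ftop).
    by have [q] := rat_in_itvoo lt; rewrite in_itv /= => qP; exists q.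
  have qlt al be : (al < be)%O -> q be < q al.
    move=> albe; rewrite -(ltr_rat R); have /andP[q1 _] := qP al.
    have /andP[_ q2] := qP be; apply: lt_trans q2 _; apply: le_lt_trans q1.
    have [_ /(_ _ albe) + _] := fP be; rewrite le_eqVlt => /predU1P[->//|lt].
    by apply/ltW/phiP.
  apply: omega1_uncountable; apply/countable_injP.
  exists (choice.pickle \o q) => al be _ _ /= /(pcan_inj choice.pickleK) qE.
  by have [/qlt|/qlt|//] := ltgtP al be; rewrite qE ltxx.
pose g (z : with_top (long_ray R)) : T :=
  if z is Some (al, t) then h (f al) t else top.
have gtop al t : (h (f al) t < next (f al))%O.
  by have [ftop _ _] := fP al; have [_ _ _ /(_ t) /andP[] _ ->] := hP _ ftop.
apply: (@order_bijection_homeomorphic _ _ _ _ g).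
  move=> [[al t]|] [[be s]|] //=; last first.
    by move=> _; apply: lt_le_trans (gtop al t) (le_top _).
  move=> /= lt; have {}lt : (al < be)%O || (al == be) && (t < s)%O.
    by move: lt; rewrite with_top_ltE ltEprodlexi /=; case: (ltgtP al be).
  case/orP: lt => [albe|/andP[/eqP<- ts]]; last first.
    by have [ftop _ _] := fP al; have [_ _ hhomo _ _] := hP _ ftop; exact: hhomo.
  apply: lt_le_trans (gtop al t) _.
  have [ftop /(_ _ albe) nextf _] := fP be; apply: le_trans nextf _.
  by have [_ _ _ /(_ s) /andP[]] := hP _ ftop.
(* Surjectivity: for the least [ga] with [G < f ga], the least upper bound property of [f ga] gives
   [be < ga] with [G < next (f be)], and minimality of [ga] gives [f be <= G]; so [G] lies in the
   chart at [f be]. *)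
move=> G; have [->|Gtop] := eqVneq G top; first by exists None.
have [ga Gga gamin] := @omega1_wf [set al | (G < f al)%O] (f_cofinal G Gtop).
have [be bega Gbe] : exists2 be, (be < ga)%O & (G < next (f be))%O.
  apply: contrapT => nobe; have [_ _ flub] := fP ga.
  have : (f ga <= G)%O.
    apply: flub => be bega; apply: not_ltT => Gbe; apply: nobe.
    by exists be.
  by move=> /(lt_le_trans Gga); rewrite ltxx.
have fbeG : (f be <= G)%O.
  by apply: not_ltT => /gamin; rewrite leNgt bega.
have [ftop _ _] := fP be; have [_ _ _ _ hsurj] := hP _ ftop.
by have [t tE] := hsurj _ fbeG Gbe; exists (Some (be, t)).
Qed.

End LongRay.

(** * The order on intermediate fields *)

Section IntermOrder.
Context {R : realType} {k K : analyticFieldType R} (iota : {rmorphism k -> K}).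
Hypothesis K_closed : closed_subfield [set: K].
Implicit Types (x y : K) (F G H : interm iota).

Local Notation ta x := (ta_closure iota [set x]).

Hypothesis ta_total : forall x y, ta x y \/ ta y x.
Hypothesis ta_proper : forall x, exists w, ~ ta x w.

Lemma interm_valP F : intermediate iota (val F).
Proof. exact/interm_predP/(valP F). Qed.

Definition mk_interm (A : set K) (iA : intermediate iota A) : interm iota :=
  Interm ((interm_predP iota A).2 iA).

Lemma interm_leP F G : (F <= G)%O <-> val F `<=` val G.
Proof. by rewrite leEsub subsetEset. Qed.

Lemma interm_ltP F G : (F < G)%O <-> val F `<=` val G /\ exists2 y, val G y & ~ val F y.
Proof.
rewrite lt_neqAle; split=> [/andP[nFG /interm_leP FG]|[FG [y Gy nFy]]].
  split=> //; apply: contrapT => noy; move/eqP: nFG; apply; apply/val_inj/seteqP.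
  by split=> // y Gy; apply: contrapT => nFy; apply: noy; exists y.
by apply/andP; split; [apply/eqP => FGE; rewrite FGE in nFy|apply/interm_leP].
Qed.

Lemma setT_intermediate : intermediate iota [set: K].
Proof. by split. Qed.

Definition interm_top : interm iota := mk_interm setT_intermediate.

Lemma interm_ntop F : F != interm_top <-> exists w, ~ val F w.
Proof.
split=> [nF|[w nFw]]; last by apply/eqP => FE; apply: nFw; rewrite FE.
apply: contrapT => /forallNP allF; move/eqP: nF; apply; apply/val_inj/seteqP.
by split=> // y _; apply: contrapT (allF y).
Qed.

Lemma interm_le_total F G : (F <= G)%O \/ (G <= F)%O.
Proof.
by have [FG|GF] := interm_total ta_total (interm_valP F) (interm_valP G);
  [left|right]; apply/interm_leP.
Qed.

Lemma interm_le_top F : (F <= interm_top)%O.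
Proof. exact/interm_leP. Qed.

Definition ta_interm_of x : interm iota := mk_interm (ta_interm iota K_closed x).

Lemma interm_countable_lub (A : set (interm iota)) : countable A -> ~ A interm_top ->
  exists2 S, S != interm_top & (forall F, A F -> (F <= S)%O) /\
    forall U, (forall F, A F -> (F <= U)%O) -> (S <= U)%O.
Proof.
move=> /countable_injP[f finj] nAtop.
pose V : set K := \bigcup_(F in A) val F.
have iS : intermediate iota (ta_closure iota V) by exact: ta_closure_intermediate.
(* [A] is enumerated by a sequence of proper fields, with the filler [ta_interm_of 0] at indices
   outside the image of [f]. A point [y] outside all of them puts the whole of [A] below the proper
   field [ta y]. *)
have /choice[u uP] n : exists F, F != interm_top /\ forall G, A G -> f G = n -> G = F.
  have [[F [AF fF]]|noF] := pselect (exists F, A F /\ f F = n).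
    exists F; split; first by apply/eqP => FE; rewrite FE in AF.
    by move=> G AG fG; apply: finj; rewrite ?inE // fG fF.
  exists (ta_interm_of 0); split; first exact/interm_ntop/ta_proper.
  by move=> G AG fG; case: noF; exists G.
have [y yP] := countable_union_proper K_closed ta_total ta_proper
  (fun n => interm_valP (u n)) (fun n => (interm_ntop (u n)).1 (uP n).1).
exists (mk_interm iS).
  have [w nyw] := ta_proper y; apply/interm_ntop; exists w => /= Vw; apply: nyw.
  move: w Vw; apply: ta_closure_min; first exact: ta_interm.
  move=> z [F AF Fz]; have [_ /(_ F AF erefl) FE] := uP (f F).
  apply: (interm_sub_ta K_closed ta_total (interm_valP F)) Fz.
  by rewrite FE; exact: yP.
split=> [F AF|U AU]; apply/interm_leP.
  by move=> z Fz; apply: sub_ta_closure; exists F.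
apply: ta_closure_min; first exact: interm_valP.
by move=> z [F AF Fz]; have /interm_leP := AU F AF; exact.
Qed.

Lemma interm_decreasing_height F : F != interm_top -> exists phi : interm iota -> R,
  forall G H, (G < H)%O -> (H <= F)%O -> phi H < phi G.
Proof.
move=> /interm_ntop[x nFx]; exists (fun G => dist x (val G)).
move=> G H /interm_ltP[GH [y Hy nGy]] /interm_leP HF.
apply: (dist_lt_interm K_closed ta_total _ _ GH _ Hy nGy); [exact: interm_valP..|].
by move/HF.
Qed.

(** For [x] outside [F], take [F' = ta x]: the fields from [F] up to but excluding [F'] are those
    above [F] that avoid [x]. Distance to [x] identifies them with the interval from 0 (excluded) to
    [D] (included), and [h t] is the field at distance [D * (1 - t)]. *)
Lemma interm_chart F : F != interm_top -> exists F' (h : ico01 R -> interm iota),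
  [/\ F' != interm_top, (F < F')%O, {homo h : s t / (s < t)%O},
      forall t, (F <= h t < F')%O &
      forall G, (F <= G)%O -> (G < F')%O -> exists t, h t = G].
Proof.
move=> /interm_ntop[x nFx]; have iF := interm_valP F; have [_ _ lF] := iF.
have d0 := dist_gt0 (interm_nonempty iF) lF nFx; set D := dist x _ in d0.
have /choice[h hP] (t : ico01 R) : exists G,
    (F <= G)%O /\ dist x (val G) = D * (1 - ico01_val t).
  have /andP[t0 t1] := valP t.
  have [||G [iG FG Gx]] := intermediate_dist_eq K_closed ta_total ta_proper iF nFx
    (rho := D * (1 - val t)).
  - by rewrite mulr_gt0 // subr_gt0.
  - by rewrite ler_piMr ?(ltW d0) // gerBl.
  - by exists (mk_interm iG); split=> //; apply/interm_leP.
have dist_inj G H : dist x (val G) < dist x (val H) -> (H < G)%O.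
  move=> GH; have HG : ~ (G <= H)%O.
    move=> /interm_leP GH'; move: GH; rewrite ltNge.
    by rewrite (dist_anti x (interm_nonempty (interm_valP G)) GH').
  have [/HG//|HleG] := interm_le_total G H.
  by rewrite lt_neqAle HleG andbT; apply/eqP => HE; apply: HG; rewrite HE.
have out G : 0 < dist x (val G) -> ~ val G x.
  by move=> G0 /(dist_le x); rewrite subrr absv0 leNgt G0.
have lt_ta G : ~ val G x -> (G < ta_interm_of x)%O.
  move=> nGx; apply/interm_ltP; split; first exact: interm_sub_ta (interm_valP G) nGx.
  by exists x => //; exact: ta_self.
exists (ta_interm_of x), h; split.
- exact/interm_ntop/ta_proper.
- exact: lt_ta.
- move=> s t st; apply: dist_inj; have [_ ->] := hP s; have [_ ->] := hP t.
  by rewrite ltr_pM2l // ltrD2l ltrN2.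
- move=> t; have [-> ht] := hP t; apply/lt_ta/out; rewrite ht.
  by have /andP[_ t1] := valP t; rewrite mulr_gt0 // subr_gt0.
move=> G /interm_leP FG /interm_ltP[GS [y Sy nGy]].
have iG := interm_valP G; have [_ _ lG] := iG.
have nGx : ~ val G x.
  by move=> Gx; apply: nGy; apply: ta_sub Sy.
have G0 := dist_gt0 (interm_nonempty iG) lG nGx.
have GD : dist x (val G) <= D := dist_anti x (interm_nonempty iF) FG.
have t01 : 0 <= 1 - dist x (val G) / D < 1.
  rewrite subr_ge0 ler_pdivrMr // mul1r GD /= ltrBlDr ltrDl.
  by rewrite divr_gt0.
exists (Ico01 t01); set t := Ico01 t01.
have hG : dist x (val (h t)) = dist x (val G).
  have [_ ->] := hP t; rewrite /t /=.
  by rewrite subKr mulrC divfK ?gt_eqF.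
(* Strict monotonicity of the distance makes the field at a given distance unique. *)
have heq H1 H2 : ~ val H2 x -> dist x (val H1) = dist x (val H2) -> ~ (H1 < H2)%O.
  move=> nH2x dE /interm_ltP[H12 [z H2z nH1z]].
  have := dist_lt_interm K_closed ta_total (interm_valP H1) (interm_valP H2) H12 nH2x H2z nH1z.
  by rewrite dE ltxx.
have nhx : ~ val (h t) x by apply: out; rewrite hG.
have [hle|hle] := interm_le_total (h t) G.
  by move: hle; rewrite le_eqVlt => /predU1P[//|/heq]; case.
by move: hle; rewrite le_eqVlt => /predU1P[//|/heq]; case.
Qed.

End IntermOrder.

Theorem corollary4p1p3 (R : realType) (k K : analyticFieldType R)
    (iota : {rmorphism k -> K})
    (iota_absv : forall x : k, absv (iota x) = absv x)
    (k_closed : GRing.closed_field_axiom k)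
    (K_closed : GRing.closed_field_axiom K)
    (K_large : large_ext iota)
    (trc1 : is_trc iota `I_1)
    (residue_char : exists p : nat, p \in [pchar (residue_field k)]) :
  homeomorphic (porder_topology (interm iota))
               (order_topology (with_top (long_ray R))).
Proof.
have cK := closed_field_setT K_closed.
have tot := trc1_ta_total cK trc1; have prop := large_ta_proper cK K_large.
apply: (@long_ray_homeomorphic R _ _ (interm_top iota cK)).
- exact: interm_le_total.
- exact: interm_le_top.
- exact: interm_countable_lub.
- exact: interm_chart.
- exact: interm_decreasing_height.
Qed.
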